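(* Fix a price vector $p\in\mathbb R_+^M$, let $X^*$ be the unique minimal maximizer of the over-demand function $\mathcal O(\cdot;p)$, and consider the problems $(P_2)$ and $(D_2)$ at $p$ defined in the context. Then: (i) the set of minimizers of $(D_2)$ forms a lattice (under componentwise order), and a unique minimal solution $z^*$ exists; (ii) the optimal value of $(D_2)$ coincides with that of $(P_2)$; (iii) the unique minimal solution $z^*$ can be expressed as $z^*=\chi_{X^*}+\gamma t$ for some $t\in\mathbb R^M$.
   Context: **Market model.** $M=\{1,\dots,m\}$ is the set of goods, $N=\{1,\dots,n\}$ with $n\ge 2$ the set of buyers, $s\in\mathbb Z_+^M$ the supply vector, and $[\mathbf 0,s]_{\mathbb Z}=\{x\in\mathbb Z_+^M : x\le s\}$ (vector inequalities are componentwise). For $x\in\mathbb R^M$ and $X\subseteq M$ put $x(X)=\sum_{j\in X}x_j$; $\chi_X\in\{0,1\}^M$ is the characteristic vector of $X$, $\chi_j=\chi_{\{j\}}$, $\chi_0=\mathbf 0$; $\operatorname{supp}_+(x)=\{j:x_j>0\}$, $\operatorname{supp}_-(x)=\{j:x_j<0\}$. Each buyer $i$ has a valuation $v_i:[\mathbf 0,s]_{\mathbb Z}\to\mathbb R_+$ with $v_i(\mathbf 0)=0$, monotone ($x\le y\Rightarrow v_i(x)\le v_i(y)$), and $\mathrm M^\natural$-concave: for all $x,x'\in[\mathbf 0,s]_{\mathbb Z}$ and $j\in\operatorname{supp}_+(x-x')$ there is $k\in\operatorname{supp}_-(x-x')\cup\{0\}$ with $v_i(x)+v_i(x')\le v_i(x-\chi_j+\chi_k)+v_i(x'+\chi_j-\chi_k)$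 (with $v_i=-\infty$ outside $[\mathbf 0,s]_{\mathbb Z}$). For each $(i,j)\in N\times M$ there is a payment function $q_{ij}:\mathbb R_+\to\mathbb R_+$ that is continuous, piecewise-linear (specified by finitely many breakpoints and slopes), strictly increasing, with $q_{ij}(0)=0$, and such that $q_{ij}(\kappa)=v_i(\chi_j)$ for some $\kappa\in\mathbb R_+$; $q'_{ij}$ denotes its right derivative. For a price vector $p\in\mathbb R_+^M$, $u_i(x;p)=v_i(x)-\sum_{j\in M}q_{ij}(p_j)x_j$, $D_i(p)=\arg\max_{x\in[\mathbf 0,s]_{\mathbb Z}}u_i(x;p)$, and $\check D_i(p)$ is the set of (componentwise) minimal elements of $D_i(p)$. **Over-demand.** $\mu_i(X;p)=\min\{x(X):x\in D_i(p)\}$ and $\mathcal O(X;p)=\sum_{i\in N}\mu_i(X;p)-s(X)$ for $X\subseteq M$. The function $\mathcal O(\cdot;p)$ is supermodular, so it has a unique inclusion-minimal maximizer. **Lexicographic primal and dual problems.** Let $\check\rho_i(X;p)=\max\{x(X):x\in\check D_i(p)\}$ and $P(\check\rho_i)=\{x\in\mathbb Z_+^M: x(S)\le\check\rho_i(S;p)\ \forall S\subseteq M\}$. Let $\gamma$ be a symbolic ''sufficiently small'' positive constant: let $\mathbb R_\gamma=\{a+\gamma b: a,b\in\mathbb R\}$ (identified with pairs $(a,b)$), with addition componentwise in $(a,b)$ and with the lexicographic order ($a_1+\gamma b_1>a_2+\gamma b_2$ iff $a_1>a_2$, or $a_1=a_2$ and $b_1>b_2$); vectors over $\mathbb R_\gamma$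 are compared componentwise. Put $w_{ij}=1-\gamma\log q'_{ij}(p_j)$ for $(i,j)\in N\times M$. $(P_2)$: maximize $\sum_{i\in N}\sum_{j\in M}w_{ij}x_{ij}$ over $(x_i)_{i\in N}$ with $x_i\in P(\check\rho_i)$ for all $i$ and $\sum_{i\in N}x_i\le s$. $(D_2)$: minimize, over $z\in\mathbb R_\gamma^M$ with $z\ge\mathbf 0$, $\mathcal L(z)=\sum_{i\in N}\max_{x_i\in P(\check\rho_i)}\sum_{j\in M}(w_{ij}-z_j)x_{ij}+\sum_{j\in M}s_jz_j$. *)

(* Defs.v *)
(* Goods are 'I_m, buyers are 'I_n, vectors are plain
   functions 'I_m -> T, ordered componentwise by the order on functions of
   mathcomp.classical.boolp. *)
From HB Require Import structures.
From mathcomp Require Import all_boot all_order all_algebra.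
From mathcomp Require Import all_classical all_reals all_analysis.

Set Implicit Arguments.
Unset Strict Implicit.
Unset Printing Implicit Defensive.

Import Order.TTheory GRing.Theory Num.Theory.
Import numFieldNormedType.Exports.

Local Open Scope classical_set_scope.
Local Open Scope ring_scope.

Section Extrema.
Context {d : Order.disp_t} {T : porderType d}.

Definition is_max (A : set T) (a : T) := A a /\ ubound A a.
Definition is_min (A : set T) (a : T) := A a /\ lbound A a.

(* x0 is a junk value, returned only if A has no maximum (resp. minimum).
   Below, A is always the image of a nonempty finite set of bundles: demand
   sets lie in [0, s], and so do the sets P(rho_i), as x in P(rho_i) gives
   x_j <= rho_i({j}) <= s_j. *)
Definition setmax (x0 : T) (A : set T) : T := xget x0 (is_max A).
Definition setmin (x0 : T) (A : set T) : T := xget x0 (is_min A).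

Definition minimals (A : set T) : set T :=
  [set x | A x /\ forall y, A y -> (y <= x)%O -> y = x].

End Extrema.

Definition sublattice {d : Order.disp_t} {T : latticeType d} (A : set T) :=
  forall x y, A x -> A y -> A (x `&` y)%O /\ A (x `|` y)%O.

(* The pair (a, b) stands for a + gamma b. *)
Definition Rgamma (R : realType) : Type := (R * R)%type.

HB.instance Definition _ (R : realType) :=
  GRing.Zmodule.copy (Rgamma R) (R * R)%type.
HB.instance Definition _ (R : realType) :=
  Order.Total.copy (Rgamma R) (R *lexi[ring_display] R)%type.

Definition gam {R : realType} (a b : R) : Rgamma R := (a, b).
Notation "a +γ b" := (gam a b) (at level 50, left associativity) : ring_scope.

Section Market.
Context {R : realType} {m : nat}.
Implicit Types (s x y : 'I_m -> nat) (X : {set 'I_m}).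

Definition vsum x X : nat := (\sum_(j in X) x j)%N.

Definition chi (o : option 'I_m) : 'I_m -> nat := fun l => (o == Some l : nat).

(* x - chi_j + chi_k, where k = None stands for k = 0.  The subtraction is
   truncated, but below it is only used when it is exact. *)
Definition exchange x (j k : option 'I_m) : 'I_m -> nat :=
  fun l => (x l - chi j l + chi k l)%N.

(* The last conjuncts say that v is not -oo at the exchanged bundles. *)
Definition mnat_concave s (v : ('I_m -> nat) -> R) :=
  forall x x', (x <= s)%O -> (x' <= s)%O -> forall j, (x' j < x j)%N ->
  exists k : option 'I_m,
    [/\ (if k is Some l then (x l < x' l)%N else true),
        v x + v x' <= v (exchange x (Some j) k) + v (exchange x' k (Some j)),
        (exchange x (Some j) k <= s)%O
      & (exchange x' k (Some j) <= s)%O].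

(* Only the values of v on [0, s] are constrained or used. *)
Definition valuation s (v : ('I_m -> nat) -> R) :=
  [/\ forall x, (x <= s)%O -> 0 <= v x,
      v (fun=> 0%N) = 0,
      forall x y, (x <= y)%O -> (y <= s)%O -> v x <= v y
    & mnat_concave s v].

(* On [0, +oo[, with breakpoints 0 :: b and slopes c. *)
Definition piecewise_linear (f : R -> R) :=
  exists (b : seq R) (c : nat -> R),
    sorted <%R (0 :: b) /\
    forall l, (l <= size b)%N -> forall t : R,
      nth 0 (0 :: b) l <= t -> ((l < size b)%N -> t < nth 0 b l) ->
      f t = f (nth 0 (0 :: b) l) + c l * (t - nth 0 (0 :: b) l).

(* Only the values of q on [0, +oo[ are constrained or used.  v (chi_j) is
   defined only if chi_j <= s, whence the guard on the last clause. *)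
Definition payment s (v : ('I_m -> nat) -> R) (j : 'I_m) (q : R -> R) :=
  [/\ {within `[0, +oo[, continuous q} /\ piecewise_linear q,
      forall a : R, 0 <= a -> 0 <= q a,
      forall a b : R, 0 <= a -> a < b -> q a < q b,
      q 0 = 0
    & (0 < s j)%N -> exists2 kappa : R, 0 <= kappa & q kappa = v (chi (Some j))].

Definition right_derivative (f : R -> R) (a : R) : R :=
  lim ((f (a + h) - f a) / h @[h --> 0^'+]).

Definition utility (v : ('I_m -> nat) -> R) (q : 'I_m -> R -> R)
    (p : 'I_m -> R) x : R :=
  v x - \sum_j q j (p j) * (x j)%:R.

Definition demand s v q p : set ('I_m -> nat) :=
  [set x | (x <= s)%O /\
           forall y, (y <= s)%O -> utility v q p y <= utility v q p x].

Definition min_demand s v q p : set ('I_m -> nat) := minimals (demand s v q p).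

Definition mu s v q p X : nat :=
  setmin 0%N [set vsum x X | x in demand s v q p].

Definition rho s v q p X : nat :=
  setmax 0%N [set vsum x X | x in min_demand s v q p].

Definition P (r : {set 'I_m} -> nat) : set ('I_m -> nat) :=
  [set x | forall X, (vsum x X <= r X)%N].

Definition minimal_maximizer (f : {set 'I_m} -> int) X :=
  (forall Y, f Y <= f X) /\
  forall Y, (forall Z, f Z <= f Y) -> Y \subset X -> Y = X.

Section Problems.
Context {n : nat} (s : 'I_m -> nat) (v : 'I_n -> ('I_m -> nat) -> R).
Context (q : 'I_n -> 'I_m -> R -> R) (p : 'I_m -> R).

Definition overdemand X : int :=
  (\sum_i mu s (v i) (q i) p X)%N%:Z - (vsum s X)%:Z.

Definition weight (i : 'I_n) (j : 'I_m) : Rgamma R :=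
  1 +γ (- ln (right_derivative (q i j) (p j))).

Definition Pi (i : 'I_n) : set ('I_m -> nat) := P (rho s (v i) (q i) p).

Definition P2_feasible : set ('I_n -> 'I_m -> nat) :=
  [set x | (forall i, Pi i (x i)) /\ forall j, (\sum_i x i j <= s j)%N].

Definition P2_objective (x : 'I_n -> 'I_m -> nat) : Rgamma R :=
  \sum_i \sum_j weight i j *+ x i j.

Definition D2_feasible : set ('I_m -> Rgamma R) := [set z | forall j, 0 <= z j].

Definition D2_objective (z : 'I_m -> Rgamma R) : Rgamma R :=
  \sum_i setmax 0 [set \sum_j (weight i j - z j) *+ x j | x in Pi i]
  + \sum_j z j *+ s j.

Definition D2_minimizers : set ('I_m -> Rgamma R) :=
  [set z | D2_feasible z /\
           forall z', D2_feasible z' -> D2_objective z <= D2_objective z'].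

End Problems.
End Market.

(* Main.v *)
(* Fix an optimal allocation x of (P_2), and give the unsold units to one more
   buyer with zero weights.  With a coordinate for "no good" added, the sets of
   feasible bundles are M-convex.  If moving a unit of buyer i from good j to
   good k is feasible, then z_k - z_j >= w_ik - w_ij is necessary for z to
   certify the optimality of x.  A closed walk of such moves with positive
   total weight and fewest steps could be performed at once, improving x; so
   there is none, and the system of difference inequalities is solvable.  Its
   solutions are the minimizers of (D_2), which gives strong duality; they form
   a lattice, whose least element is the limit of the Bellman-Ford iteration
   started at 0.

   Comparing real parts, the level sets of a minimizer z are maximizers of the
   over-demand, hence contain X*; and outside X* the real part of the least
   minimizer vanishes, since otherwise it could be lowered uniformly. *)
Require Import Defs.
From HB Require Import structures.
From mathcomp Require Import all_boot all_order all_algebra.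
From mathcomp Require Import all_classical all_reals all_analysis.
From mathcomp Require Import zify lra.

Set Implicit Arguments.
Unset Strict Implicit.
Unset Printing Implicit Defensive.

Import Order.TTheory GRing.Theory Num.Theory.
Import numFieldNormedType.Exports.

Local Open Scope classical_set_scope.
Local Open Scope ring_scope.

(** * Ordered group laws of [Rgamma] *)

Section OrderedGroup.
Context {R : realType}.
Implicit Types x y z : Rgamma R.

Lemma gext x y : x.1 = y.1 -> x.2 = y.2 -> x = y.
Proof. by case: x => a b; case: y => c d /= -> ->. Qed.

(** The group and the order of [Rgamma] are declared separately; passing to the two real components
    lets [lra] prove the laws that link them. *)
Lemma gleP x y : reflect (x.1 < y.1 \/ x.1 = y.1 /\ x.2 <= y.2) (x <= y).
Proof.
rewrite Order.ProdLexiOrder.leEprodlexi; apply: (iffP andP).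
- move=> [h1 /implyP h2]; move: h1 h2; rewrite le_eqVlt => /orP[/eqP e|l _].
    by rewrite e lexx => /(_ isT); right.
  by left.
- by move=> [l|[e l]]; [rewrite ltW // leNgt l | rewrite e lexx].
Qed.

Lemma gltP x y : reflect (x.1 < y.1 \/ x.1 = y.1 /\ x.2 < y.2) (x < y).
Proof.
rewrite Order.ProdLexiOrder.ltEprodlexi; apply: (iffP andP).
- move=> [h1 /implyP h2]; move: h1 h2; rewrite le_eqVlt => /orP[/eqP e|l _].
    by rewrite e lexx => /(_ isT); right.
  by left.
- by move=> [l|[e l]]; [rewrite ltW // leNgt l | rewrite e lexx].
Qed.

Lemma glt_total x y : x < y \/ y <= x.
Proof. by case: (ltP x y); [left|right]. Qed.

Lemma gsub_ge0 x y : (0 <= y - x) = (x <= y).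
Proof. by apply/gleP/gleP => /= -[]; lra. Qed.

Lemma gsub_gt0 x y : (0 < y - x) = (x < y).
Proof. by apply/gltP/gltP => /= -[]; lra. Qed.

Lemma gleD2r z x y : (x + z <= y + z) = (x <= y).
Proof. by apply/gleP/gleP => /= -[]; lra. Qed.

Lemma gleBDr z x y : (x + z <= y) = (x <= y - z).
Proof. by rewrite -{1}(subrK z y) gleD2r. Qed.

Lemma gaddr_ge0 x y : 0 <= x -> 0 <= y -> 0 <= x + y.
Proof. by move=> /gleP /= + /gleP /= => ??; apply/gleP => /=; lra. Qed.

End OrderedGroup.

(** * M-convex sets and simultaneous exchanges *)

Section MConvex.
Context {J : finType}.
Implicit Types (x y : {ffun J -> int}) (B : set {ffun J -> int}).

Definition unitv (j : J) : {ffun J -> int} := [ffun l => (l == j)%:Z].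

Definition mconvex B := forall x y j, B x -> B y -> y j < x j ->
  exists k, [/\ x k < y k, B (x - unitv j + unitv k) & B (y - unitv k + unitv j)].

(* The exchange r whose pair (U r, r) is least is performed last: no chord
   leaves r, so M-convexity, applied to the result of r alone and the result
   of all the others, can only trade hj r for hk r. *)
Lemma multi_exchange {d} {G : orderType d} (l : nat) B x (hj hk : 'I_l -> J)
    (U : 'I_l -> G) (A : {set 'I_l}) :
  mconvex B -> B x ->
  (forall a, a \in A -> B (x - unitv (hj a) + unitv (hk a))) ->
  (forall a b, a \in A -> b \in A -> a != b ->
     B (x - unitv (hj a) + unitv (hk b)) ->
     (U b <= U a)%O /\ ((a < b)%N -> (U b < U a)%O)) ->
  B (x + \sum_(a in A) (unitv (hk a) - unitv (hj a))).
Proof.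
move=> BM Bx; move: {2}#|A| (erefl #|A|) => c; elim: c A => [|c IH] A cA arcA chordA.
  by move: (cards0_eq cA) => ->; rewrite big_set0 addr0.
have /set0Pn[a0 a0A] : A != finset.set0 by rewrite -card_gt0 cA.
pose a1 := [arg min_(a < a0 in A) U a]%O.
have [a1A a1min] : a1 \in A /\ forall b, b \in A -> (U a1 <= U b)%O.
  by rewrite /a1; case: (@Order.TotalTheory.arg_minP _ _ _ a0 (mem A) U) => // i iA h; split.
pose r := [arg min_(a < a1 | (a \in A) && (U a <= U a1)%O) (a : nat)].
have [rA rU rmin] : [/\ r \in A, (U r <= U a1)%O
    & forall b : 'I_l, b \in A -> (U b <= U a1)%O -> (r <= b)%N].
  rewrite /r; case: arg_minnP => [|i /andP[iA iU] h]; first by rewrite a1A lexx.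
  by split=> // b bA bU; apply: h; rewrite bA bU.
have nochord b : b \in A -> b != r -> ~ B (x - unitv (hj r) + unitv (hk b)).
  move=> bA br Brb.
  have [Ubr Ult] := chordA _ _ rA bA (ltac:(by rewrite eq_sym)) Brb.
  have Ub1 : (U b <= U a1)%O by apply: le_trans rU.
  have rb := rmin _ bA Ub1.
  have : (r < b)%N by rewrite ltn_neqAle rb andbT eq_sym br.
  by move=> /Ult; rewrite ltNge (le_trans rU (a1min _ bA)).
have ByA : B (x + \sum_(a in A :\ r) (unitv (hk a) - unitv (hj a))).
  apply: IH.
  - by have := cardsD1 r A; rewrite rA cA add1n => -[].
  - by move=> a /setD1P[_]; apply: arcA.
  - by move=> a b /setD1P[_ aA] /setD1P[_ bA]; apply: chordA.
rewrite (big_setD1 r) //=.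
set S := \sum_(a in A :\ r) _ in ByA *.
have Sk k : S k = \sum_(a in A :\ r) ((k == hk a)%:Z - (k == hj a)%:Z).
  by rewrite /S sum_ffunE; apply: eq_bigr => a _; rewrite !ffunE.
move: S Sk ByA => S Sk ByA.
have [kj|kj] := eqVneq (hk r) (hj r); first by rewrite kj subrr add0r.
(* If [hk a = hk r] for another [a], the arc of [r] itself would be a chord from [r] to [a]. *)
have Skr : S (hk r) <= 0.
  rewrite Sk; apply: sumr_le0 => a /setD1P[ar aA].
  have [e|_] := eqVneq (hk r) (hk a); last by rewrite sub0r oppr_le0.
  by case: (nochord a aA ar); rewrite -e; apply: arcA.
have lt1 : (x + S) (hk r) < (x - unitv (hj r) + unitv (hk r)) (hk r).
  by rewrite !ffunE eqxx (negbTE kj) subr0 ltrD2l (le_lt_trans Skr).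
have [b [ltb Bx1 By1]] := BM _ _ _ (arcA _ rA) ByA lt1.
have [bj|bj] := eqVneq b (hj r).
  move: By1; rewrite bj; congr B.
  by rewrite -!addrA; congr (_ + _); rewrite addrC (addrC (- _)) -addrA.
(* A coordinate raised by [S] is some [hk a], and then the vector in [Bx1] is a chord from [r] to
   [a]. *)
have Sb : 0 < S b.
  move: ltb; rewrite !ffunE (negbTE bj) subr0 ltrD2l; exact: le_lt_trans.
have [a /andP[aD /eqP ba]|noa] := pickP [pred a in A :\ r | b == hk a].
  move: aD => /setD1P[ar aA]; case: (nochord a aA ar).
  by move: Bx1; rewrite ba addrK.
exfalso; move: Sb; rewrite ltNge => /negP; apply; rewrite Sk.
apply: sumr_le0 => a aD; have := noa a; rewrite /= aD /= => ->.
by rewrite sub0r oppr_le0.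
Qed.

End MConvex.

(** * Linear functionals on integer vectors with values in [Rgamma] *)

Section Linear.
Context {R : realType} {J : finType}.
Implicit Types (w : J -> Rgamma R) (y : {ffun J -> int}).

Definition lin w y : Rgamma R := \sum_j w j *~ y j.

Lemma linD w y z : lin w (y + z) = lin w y + lin w z.
Proof.
by rewrite /lin -big_split; apply: eq_bigr => j _; rewrite ffunE mulrzDr.
Qed.

Lemma linN w y : lin w (- y) = - lin w y.
Proof. by rewrite /lin -sumrN; apply: eq_bigr => j _; rewrite ffunE mulrNz. Qed.

Lemma lin0 w : lin w 0 = 0.
Proof. by rewrite /lin big1 // => j _; rewrite ffunE mulr0z. Qed.

Lemma lin_unitv w k : lin w (unitv k) = w k.
Proof.
rewrite /lin (bigD1 k) //= ffunE eqxx big1 ?addr0 // => j /negbTE jk.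
by rewrite ffunE jk mulr0z.
Qed.

Lemma lin_sum w (T : Type) (r : seq T) (P : pred T) (F : T -> {ffun J -> int}) :
  lin w (\sum_(a <- r | P a) F a) = \sum_(a <- r | P a) lin w (F a).
Proof. by apply: (big_morph (lin w)); [exact: linD | exact: lin0]. Qed.

End Linear.

(** * Walks of exchanges and potentials *)

Section Walks.
Context {R : realType} {I J : finType}.
Context (B : I -> set {ffun J -> int}) (w : I -> J -> Rgamma R).
Context (x : I -> {ffun J -> int}).
Implicit Types (b : nat -> I) (g : nat -> J) (i : I).

Definition exch i j k := B i (x i - unitv j + unitv k).

(** Arc number [u] leads from [g u] to [g u.+1] and is an exchange of buyer [b u]; the sum is the
    change in total weight. *)
Definition len b g (s t : nat) : Rgamma R :=
  \sum_(s <= u < t) (w (b u) (g u.+1) - w (b u) (g u)).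

Definition pos_closed_walk (l : nat) b g :=
  [/\ g l = g 0%N, forall u, (u < l)%N -> exch (b u) (g u) (g u.+1)
    & 0 < len b g 0 l].

Lemma len_cat b g (s t u : nat) : (s <= t)%N -> (t <= u)%N ->
  len b g s u = len b g s t + len b g t u.
Proof. by move=> st tu; rewrite /len -big_cat_nat. Qed.

Lemma len_shift b g (h s t : nat) :
  len (fun u => b (h + u)%N) (fun u => g (h + u)%N) s t = len b g (h + s) (h + t).
Proof.
rewrite /len (addnC h s) big_addn addnC addnK; apply: eq_bigr => u _.
by rewrite addnS (addnC u h).
Qed.

(** Serves to close a stretch of a longer walk by a chord that leads back to its first vertex. *)
Lemma close_walk (n : nat) b g i :
  (forall u, (u < n)%N -> exch (b u) (g u) (g u.+1)) -> exch i (g n) (g 0%N) ->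
  0 < len b g 0 n + (w i (g 0%N) - w i (g n)) ->
  exists b' g', pos_closed_walk n.+1 b' g'.
Proof.
move=> arcs arci lpos.
exists (fun u => if (u < n)%N then b u else i),
       (fun u => if (u <= n)%N then g u else g 0%N); split=> /=.
- by rewrite ltnn.
- move=> u; rewrite ltnS => un; have [->|] := eqVneq u n; first by rewrite ltnn leqnn.
  move: un; rewrite [in X in X -> _]leq_eqVlt => /orP[->//|un _].
  by rewrite un (ltnW un); apply: arcs.
- rewrite /len big_nat_recr //= ltnn leqnn.
  move: lpos; congr (0 < _ + _); apply: eq_big_nat => u /andP[_ un].
  by rewrite un (ltnW un).
Qed.

Hypothesis Bconvex : forall i, mconvex (B i).
Hypothesis Bx : forall i, B i (x i).
Hypothesis x_opt : forall y, (forall i, B i (y i)) -> \sum_i y i = \sum_i x i ->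
  \sum_i lin (w i) (y i) <= \sum_i lin (w i) (x i).

(* In a positive closed walk with fewest arcs, each chord between two arcs of
   the same buyer closes a shorter walk, hence a nonpositive one.  This orders
   the exchanges of each buyer so that they can be performed together, giving
   an improvement of x. *)
Lemma no_pos_closed_walk (l : nat) b g : ~ pos_closed_walk l b g.
Proof.
elim/ltn_ind: l b g => l IH b0 g0 [gl arcs0 pos0].
case: (posnP l) => [l0|l0]; first by move: pos0; rewrite l0 /len big_geq // ltxx.
(* The walk is continued periodically, so that a stretch through the starting point is an interval
   of indices too. *)
pose b u := b0 (u %% l)%N; pose g u := g0 (u %% l)%N.
have gS u : g u.+1 = g0 (u %% l).+1.
  rewrite /g -addn1 -modnDml addn1.
  have : (u %% l < l)%N by rewrite ltn_mod.
  rewrite leq_eqVlt => /orP[/eqP->|h]; first by rewrite modnn gl.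
  by rewrite (modn_small h).
have arcs u : exch (b u) (g u) (g u.+1) by rewrite gS; apply: arcs0; rewrite ltn_mod.
have gD u : g (l + u)%N = g u by rewrite /g modnDl.
have bD u : b (l + u)%N = b u by rewrite /b modnDl.
have Dpos : 0 < len b g 0 l.
  move: pos0; congr (0 < _); apply: eq_big_nat => u /andP[_ ul].
  by rewrite gS /b /g (modn_small ul).
pose p u := len b g 0 u.
have lenp h t : (h <= t)%N -> len b g h t = p t - p h.
  by move=> ht; rewrite /p (@len_cat b g 0 h t) // addrAC subrr add0r.
have pD u : p (l + u)%N = p l + p u.
  rewrite /p (@len_cat b g 0 l (l + u)) ?leq_addr //; congr (_ + _).
  have := @len_shift b g l 0 u; rewrite addn0 => <-; apply: eq_bigr => t _.
  by rewrite /= bD !gD.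
(* The stretch from [h] to [a] and the chord form a closed walk of [(a - h).+1 < l] arcs, so the
   induction hypothesis applies. *)
have chord i h a : (h <= a)%N -> (a - h < l.-1)%N -> exch i (g a) (g h) ->
    (p a - p h) + (w i (g h) - w i (g a)) <= 0.
  move=> ha al arci; case: (glt_total 0 ((p a - p h) + (w i (g h) - w i (g a)))) => // lpos.
  have [b' [g']] : exists b' g', pos_closed_walk (a - h).+1 b' g'.
    apply: (@close_walk _ (fun u => b (h + u)%N) (fun u => g (h + u)%N) i).
    - by move=> u _; rewrite addnS; apply: arcs.
    - by rewrite addn0 subnKC.
    - by rewrite len_shift addn0 subnKC // lenp.
  move=> pw; exfalso; apply: (IH _ _ _ _ pw).
  by rewrite -ltnS prednK in al.
pose hj (a : 'I_l) := g a; pose hk (a : 'I_l) := g a.+1.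
pose A i := [set a : 'I_l | b a == i]%SET.
pose y i := x i + \sum_(a in A i) (unitv (hk a) - unitv (hj a)).
have By i : B i (y i).
  (* The key [w i (g a) - p a] has the same value at both ends of an arc of buyer [i], so it
     compares a chord with the stretch that it closes. *)
  apply: (@multi_exchange _ _ _ l _ _ hj hk (fun a => w i (g a) - p a)) => //.
    by move=> a; rewrite inE => /eqP <-; apply: arcs.
  move=> a c _; rewrite inE => /eqP ci ac arci.
  have Uc : w i (g c) - p c = w i (g c.+1) - p c.+1.
    have := lenp c c.+1 (leqnSn _); rewrite /len big_nat1 ci => e.
    by apply: gext; move: (congr1 fst e) (congr1 snd e) => /=; lra.
  (* If [a < c], the stretch runs from [c.+1] past the end of the period to [l + a]; the term
     [p l > 0] then makes the inequality strict. *)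
  rewrite Uc; case: (ltngtP a c) => [lt_ac|lt_ca|/val_inj e]; last by rewrite e eqxx in ac.
  - have := @chord i c.+1 (l + a)%N; rewrite gD => /(_ _ _ arci); rewrite pD.
    move=> /(_ ltac:(by case: (c) => /= c' + ; lia) ltac:(by case: (c) lt_ac => /= c' + +; lia)) h.
    have lt : w i (g c.+1) - p c.+1 < w i (g a) - p a.
      by move: h Dpos; rewrite -/(p l) => /gleP /= h /gltP /= h'; apply/gltP => /=; lra.
    by split => // ; apply: ltW.
  - split=> //; have := @chord i c.+1 a lt_ca _ arci.
    move=> /(_ ltac:(by case: (a) lt_ca => /= a' + +; lia)).
    by move=> /gleP /= h; apply/gleP => /=; lra.
have sumy (V : zmodType) (F : nat -> V) : \sum_(a < l) (F a.+1 - F a) = F l - F 0%N.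
  by rewrite -(big_mkord xpredT (fun a => F a.+1 - F a)) telescope_sumr.
have part (V : zmodType) (F : 'I_l -> I -> V) :
    \sum_i \sum_(a in A i) F a i = \sum_(a < l) F a (b a).
  rewrite (exchange_big_dep predT) //=; apply: eq_bigr => a _.
  by rewrite (big_pred1 (b a)) // => i; rewrite inE eq_sym.
have := x_opt By; rewrite /y big_split /= (part _ (fun a _ => unitv (hk a) - unitv (hj a))).
rewrite (sumy _ (fun u => unitv (g u))) -{1}(addn0 l) gD subrr addr0 => /(_ erefl).
rewrite leNgt => /negP; apply.
under [X in _ < X]eq_bigr do rewrite linD lin_sum.
rewrite big_split /= (part _ (fun a i => lin (w i) (unitv (hk a) - unitv (hj a)))).
rewrite -gsub_gt0 addrAC subrr add0r.
move: Dpos; congr (0 < _); rewrite /len big_mkord; apply: eq_bigr => a _.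
by rewrite linD linN !lin_unitv.
Qed.

(* The iterates of the Bellman-Ford recursion, started at 0. *)
Fixpoint pot (t : nat) (k : J) : Rgamma R :=
  if t is t'.+1 then
    \big[Order.max/pot t' k]_(ij : I * J | `[< exch ij.1 ij.2 k >])
      (pot t' ij.2 + (w ij.1 k - w ij.1 ij.2))
  else 0.

Definition potential (z : J -> Rgamma R) :=
  forall i j k, exch i j k -> z j + (w i k - w i j) <= z k.

Lemma pot_leS t k : pot t k <= pot t.+1 k.
Proof. exact: bigmax_ge_id. Qed.

Lemma pot_le s t k : (s <= t)%N -> pot s k <= pot t k.
Proof.
move=> /subnK <-; elim: (t - s)%N => [|n IH]; first by rewrite add0n.
by rewrite addSn (le_trans IH) // pot_leS.
Qed.

Lemma pot_arc t i j k : exch i j k -> pot t j + (w i k - w i j) <= pot t.+1 k.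
Proof.
move=> a /=; apply: (bigmax_sup (i, j)) => //=; exact/asboolP.
Qed.

Lemma pot_step t k : pot t k < pot t.+1 k ->
  exists i j, exch i j k /\ pot t.+1 k = pot t j + (w i k - w i j).
Proof.
suff : pot t.+1 k = pot t k \/
    exists i j, exch i j k /\ pot t.+1 k = pot t j + (w i k - w i j).
  by move=> [->|//]; rewrite ltxx.
rewrite /=; elim/big_rec: _ => [|[i j] v /= /asboolP a [->|h]]; first by left.
- by rewrite maxEle; case: ifP => _; [left|right; exists i, j].
- by rewrite maxEle; case: ifP => _; right; [|exists i, j].
Qed.

(** A strict increase at [k] in the last step comes along an arc from some [j] that itself increased
    strictly one step earlier; otherwise [pot_arc] would have given [k] its new value before. *)
Lemma pot_backtrack t k : pot t k < pot t.+1 k ->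
  exists b g, g t.+1 = k /\ forall u, (u <= t)%N ->
    [/\ exch (b u) (g u) (g u.+1),
        pot u.+1 (g u.+1) = pot u (g u) + (w (b u) (g u.+1) - w (b u) (g u))
      & pot u (g u.+1) < pot u.+1 (g u.+1)].
Proof.
elim: t k => [|t IH] k lt_k; have [i [j [aijk ek]]] := pot_step lt_k.
  exists (fun=> i), (fun u => if u is 0 then j else k); split=> // u.
  by rewrite leqn0 => /eqP->.
have lt_j : pot t j < pot t.+1 j.
  rewrite lt_neqAle pot_leS andbT; apply/eqP => e.
  by move: lt_k; rewrite ek -e ltNge pot_arc.
have [b [g [gj bgP]]] := IH j lt_j.
exists (fun u => if u == t.+1 then i else b u),
       (fun u => if u == t.+2 then k else g u); split; first by rewrite eqxx.
move=> u; rewrite leq_eqVlt => /orP[/eqP->|ut].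
  by rewrite !eqxx ltn_eqF // gj.
rewrite ltnS in ut; have [? ? ?] := bgP u ut.
by rewrite !ltn_eqF // ?ltnS // ltnW.
Qed.

(** A late increase traces back a walk whose first [#|J|.+1] vertices contain a repetition. The
    closed part has as length the increase of [pot] at the repeated vertex, which is positive. *)
Lemma pot_stable k : pot #|J|.+1 k = pot #|J| k.
Proof.
apply/eqP; rewrite eq_sym; apply/negPn/negP => ne.
have [b [g [_ bgP]]] : exists b g, g #|J|.+1 = k /\ forall u, (u <= #|J|)%N ->
    [/\ exch (b u) (g u) (g u.+1),
        pot u.+1 (g u.+1) = pot u (g u) + (w (b u) (g u.+1) - w (b u) (g u))
      & pot u (g u.+1) < pot u.+1 (g u.+1)].
  by apply: pot_backtrack; rewrite lt_neqAle ne pot_leS.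
have /injectivePn[s [s' ss' gss']] : ~~ injectiveb (fun u : 'I_#|J|.+1 => g u).
  by apply/injectiveP => /leq_card; rewrite card_ord ltnn.
wlog lt_ss' : s s' ss' gss' / (s < s')%N.
  move=> W; case: (ltngtP s s') => [h|h|/val_inj e]; first exact: (W s s').
    by apply: (W s' s) => //; rewrite eq_sym.
  by rewrite e eqxx in ss'.
have lenE u v : (u <= v)%N -> (v <= #|J|.+1)%N -> len b g u v = pot v (g v) - pot u (g u).
  move=> uv; rewrite -(subnK uv); elim: (v - u)%N => [|n IH] nu.
    by rewrite add0n /len big_geq // subrr.
  rewrite addSn in nu *; rewrite (@len_cat b g u (n + u)) ?leq_addl // IH 1?ltnW //.
  rewrite /len big_nat1; have [_ -> _] := bgP _ nu.
  by apply: gext => /=; lra.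
have ls' : (s' <= #|J|)%N by rewrite -ltnS.
apply: (@no_pos_closed_walk (s' - s) (fun u => b (s + u)%N) (fun u => g (s + u)%N)).
split.
- by rewrite subnKC ?addn0 1?ltnW // gss'.
- move=> u us; rewrite addnS; have su : (s + u <= #|J|)%N.
    by move: us; rewrite ltn_subRL => us; rewrite (leq_trans (ltnW us)).
  by have [] := bgP _ su.
- rewrite (len_shift b g s) addn0 subnKC 1?ltnW // lenE 1?ltnW //.
  rewrite gsub_gt0 gss'; case: (s') lt_ss' ls' => -[//|v] /= _ sv vJ.
  have [_ _] := bgP v (ltnW vJ); apply: le_lt_trans; exact: pot_le.
Qed.

Lemma pot_potential : potential (pot #|J|).
Proof. by move=> i j k /(pot_arc #|J|); rewrite pot_stable. Qed.

Lemma pot_least z t k : (forall j, 0 <= z j) -> potential z -> pot t k <= z k.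
Proof.
move=> z0 zP; elim: t k => [|t IH] k //=; apply/bigmax_leP; split=> // -[i j] /=.
move=> /asboolP /zP; apply: le_trans.
by move: (IH j) => /gleP /= h; apply/gleP => /=; lra.
Qed.

End Walks.

(** * Local optimality implies global optimality on M-convex sets *)

Section LocalGlobal.
Context {R : realType} {J : finType}.

(** Induction on the l1 distance: an exchange between [x] and [y] brings [y] closer to [x], and
    local optimality at [x] shows that it does not lower the value of [y]. *)
Lemma local_global (B : set {ffun J -> int}) (u : J -> Rgamma R) x y :
  mconvex B -> B x -> (forall j k, B (x - unitv j + unitv k) -> u k <= u j) ->
  B y -> lin u y <= lin u x.
Proof.
move=> BM Bx loc; have [n] := ubnP (\sum_l `|x l - y l|)%N.
elim: n y => // n IH y dn By.
have [->//|nxy] := eqVneq y x.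
have [j [k [jk1 jk2 Bx1 By1]]] : exists j k, [/\ y j < x j, x k < y k,
    B (x - unitv j + unitv k) & B (y - unitv k + unitv j)].
  have [j] : exists j, y j != x j.
    apply/existsP; apply: contraNT nxy; rewrite negb_exists => /forallP h.
    by apply/eqP/ffunP => j; apply/eqP/negPn.
  rewrite neq_lt => /orP[] lt_j.
    by have [k []] := BM x y j Bx By lt_j; exists j, k.
  by have [k []] := BM y x j By Bx lt_j; exists k, j.
have lt1 : lin u y <= lin u (y - unitv k + unitv j).
  rewrite !linD linN !lin_unitv; move: (loc _ _ Bx1).
  by move=> /gleP /= h; apply/gleP => /=; lra.
apply: (le_trans lt1); apply: IH By1; move: dn; rewrite ltnS; apply: leq_trans.
rewrite (bigD1 j) //= [X in (_ < X)%N](bigD1 j) //= -addSn; apply: leq_add.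
  rewrite !ffunE eqxx; have -> : (j == k) = false.
    by apply/eqP => e; move: jk1; rewrite e ltNge (ltW jk2).
  by rewrite subr0; move: (x j) (y j) jk1 => a b; lia.
apply: leq_sum => l /negbTE lj; rewrite !ffunE lj addr0.
by have [->|_] := eqVneq l k; [move: (x k) (y k) jk2 => a b; lia | rewrite subr0].
Qed.

End LocalGlobal.

(** * Maxima over bounded sets of bundles *)

Section Extrema.

(** Functions bounded by [b] are encoded in a finite type of functions to an ordinal, where a
    maximum exists. *)
Lemma bounded_max (E : finType) {d} {T : orderType d} (b : E -> nat)
    (A : set (E -> nat)) (f : (E -> nat) -> T) :
  (forall x, A x -> forall e, (x e <= b e)%N) -> (exists x, A x) ->
  exists x, A x /\ forall y, A y -> (f y <= f x)%O.
Proof.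
move=> Ab [x0 Ax0]; pose N := (\max_e b e)%N.
pose dec (g : {ffun E -> 'I_N.+1}) : E -> nat := fun e => g e.
have decE x : A x -> dec [ffun e => inord (x e)] = x.
  move=> Ax; apply/funext => e; rewrite /dec ffunE inordK // ltnS.
  exact: leq_trans (Ab _ Ax e) (leq_bigmax e).
pose P g := `[< A (dec g) >].
have P0 : P [ffun e => inord (x0 e)] by apply/asboolP; rewrite decE.
case: (@Order.TotalTheory.arg_maxP _ _ _ _ P (f \o dec) P0) => g /asboolP Ag gmax.
exists (dec g); split=> // y Ay; rewrite -(decE _ Ay).
by apply: gmax; apply/asboolP; rewrite decE.
Qed.

Context {d : Order.disp_t} {T : porderType d}.
Implicit Types (A : set T) (a : T).

Lemma setmax_eq x0 A a : is_max A a -> setmax x0 A = a.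
Proof.
move=> [Aa ua]; rewrite /setmax; case: xgetP => [y _ [Ay uy]|/(_ a) []//].
by apply/le_anti; rewrite ua // uy.
Qed.

Lemma setmin_eq x0 A a : is_min A a -> setmin x0 A = a.
Proof.
move=> [Aa ua]; rewrite /setmin; case: xgetP => [y _ [Ay uy]|/(_ a) []//].
by apply/le_anti; rewrite ua // uy.
Qed.

End Extrema.

(** * Exchanges of goods and homogenized bundles *)

Section Bundles.
Context {m : nat}.
Implicit Types (x y b c : 'I_m -> nat) (X Y : {set 'I_m}) (j k : option 'I_m).

Local Notation full := [set: 'I_m]%SET.

Definition oin j X : bool := if j is Some l then l \in X else false.

Definition removable x j : bool := if j is Some l then (0 < x l)%N else true.

Lemma vsumE x X : vsum x X = (\sum_j (j \in X) * x j)%N.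
Proof.
by rewrite /vsum big_mkcond; apply: eq_bigr => j _; case: (j \in X); rewrite ?mul1n.
Qed.

Lemma vsum0 x : vsum x finset.set0 = 0%N.
Proof. by rewrite /vsum big_set0. Qed.

Lemma vsum_modular x X Y :
  (vsum x (X :|: Y) + vsum x (X :&: Y) = vsum x X + vsum x Y)%N.
Proof.
rewrite !vsumE -!big_split; apply: eq_bigr => j _ /=.
by rewrite !inE; case: (j \in X); case: (j \in Y); lia.
Qed.

Lemma vsum_setC x X : (vsum x X + vsum x (~: X) = vsum x full)%N.
Proof. by rewrite -vsum_modular finset.setUCr finset.setICr vsum0 addn0. Qed.

Lemma leq_vsum x y X : (forall l, l \in X -> (x l <= y l)%N) ->
  (vsum x X <= vsum y X)%N.
Proof. by move=> le_xy; apply: leq_sum. Qed.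

Lemma vsum_lt x y X : (vsum x X < vsum y X)%N -> exists2 l, l \in X & (x l < y l)%N.
Proof.
move=> lt_xy; apply/exists_inP; apply: contraLR lt_xy => /exists_inPn h.
by rewrite -leqNgt; apply: leq_vsum => l /h; rewrite -leqNgt.
Qed.

(** Adding on both sides keeps truncated subtraction out of the later arithmetic. *)
Lemma exchangeE x j k l : j != k -> removable x j ->
  (exchange x j k l + (j == Some l) = x l + (k == Some l))%N.
Proof.
rewrite /exchange /chi => jk; case: j jk => [j|] jk /= xj; last by rewrite subn0 addn0.
have [e|_] := eqVneq (Some j) (Some l); last by rewrite subn0 addn0.
by case: e xj jk => -> xj /negbTE; rewrite eq_sym => ->; lia.
Qed.

Lemma sum_oin k X : (\sum_(l in X) (k == Some l) = oin k X)%N.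
Proof.
case: k => [k|] /=; last by rewrite big1.
have [kX|kX] := boolP (k \in X).
  rewrite (bigD1 k) //= eqxx big1 // => l /andP[_ /negbTE lk].
  by apply/eqP; rewrite eqb0; apply/eqP => -[e]; rewrite e eqxx in lk.
rewrite big1 // => l lX; apply/eqP; rewrite eqb0; apply/eqP => -[e].
by rewrite e lX in kX.
Qed.

Lemma vsum_exchange x j k X : j != k -> removable x j ->
  (vsum (exchange x j k) X + oin j X = vsum x X + oin k X)%N.
Proof.
move=> jk xj; rewrite -!sum_oin /vsum -!big_split /=.
by apply: eq_bigr => l _; apply: exchangeE.
Qed.

Definition dist x y : nat := (\sum_l ((x l - y l) + (y l - x l)))%N.

(** This decrease is what terminates the exchange inductions on bundles. *)
Lemma dist_exchange x y (j k : 'I_m) : (x j < y j)%N -> (y k < x k)%N ->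
  (dist (exchange x (Some k) (Some j)) y < dist x y)%N.
Proof.
move=> xj yk; have kj : Some k != Some j.
  by apply/eqP => -[e]; move: xj yk; rewrite e; lia.
have ex l := @exchangeE x (Some k) (Some j) l kj (leq_ltn_trans (leq0n _) yk).
rewrite /dist (bigD1 j) //= [X in (_ < X)%N](bigD1 j) //= -addSn; apply: leq_add.
  have := ex j; rewrite eqxx (negbTE kj) addn0 addn1 => ->; lia.
apply: leq_sum => l lj; have := ex l.
have [[<-]|_] := eqVneq (Some k) (Some l).
  have -> : (Some j == Some k) = false by rewrite eq_sym (negbTE kj).
  lia.
have -> : (Some j == Some l) = false by apply/eqP => -[e]; rewrite e eqxx in lj.
lia.
Qed.

Lemma distC x y : dist x y = dist y x.
Proof. by apply: eq_bigr => l _; rewrite addnC. Qed.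

(* The coordinate None makes the coordinate sum vanish; it turns the exchange
   property of Mnat-convex sets into that of M-convex sets. *)
Definition homog x : {ffun option 'I_m -> int} :=
  [ffun o => if o is Some l then (x l)%:Z else - (vsum x full)%:Z].

Lemma homog_exchange x j k : j != k -> removable x j ->
  homog (exchange x j k) = homog x - unitv j + unitv k.
Proof.
move=> jk xj; apply/ffunP => -[l|]; rewrite !ffunE.
  have := exchangeE l jk xj; rewrite ![Some l == _]eq_sym.
  by move: (exchange x j k l) (x l) => a b; case: (j == _); case: (k == _) => /=; lia.
have := vsum_exchange full jk xj.
have oinT o : oin o full = ~~ (None == o) by case: o => //= l; rewrite inE.
by rewrite !oinT; case: (None == j); case: (None == k); rewrite /=; lia.
Qed.

(** The M-convexity of the homogenized set, stated on bundles. The two strict inequalities make [j]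
    removable from [x] and [k] from [y], so no subtraction is truncated. *)
Definition hconvex (A : set ('I_m -> nat)) := forall x y j, A x -> A y ->
  homog y j < homog x j ->
  exists k, [/\ homog x k < homog y k, A (exchange x j k) & A (exchange y k j)].

Lemma homog_lt_removable x y j : homog y j < homog x j -> removable x j.
Proof. by case: j => [j|] //=; rewrite !ffunE; lia. Qed.

Lemma hconvex_mconvex A : hconvex A -> mconvex (homog @` A).
Proof.
move=> AX _ _ j [x Ax <-] [y Ay <-] yx; have [k [xy Ax' Ay']] := AX _ _ _ Ax Ay yx.
have jk : j != k by apply/eqP => e; move: xy; rewrite -e ltNge (ltW yx).
exists k; split=> //.
- by exists (exchange x j k) => //; rewrite homog_exchange // (homog_lt_removable yx).
- exists (exchange y k j) => //.
  by rewrite homog_exchange 1?eq_sym // (homog_lt_removable xy).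
Qed.

Lemma hconvexT : hconvex setT.
Proof.
move=> x y j _ _; case: j => [j|]; rewrite !ffunE => lt_j.
- have [yx|xy] := ltnP (vsum y full) (vsum x full).
    by exists None; split=> //; rewrite !ffunE; lia.
  have [l _ lt_l] : exists2 l, l \in ~: [set j]%SET & (x l < y l)%N.
    apply: vsum_lt; have := vsum_setC x [set j]%SET; have := vsum_setC y [set j]%SET.
    by rewrite /vsum !big_set1 -!/(vsum _ _); rewrite /vsum in xy *; lia.
  by exists (Some l); split=> //; rewrite !ffunE.
- have [l _ lt_l] : exists2 l, l \in full & (x l < y l)%N.
    by apply: vsum_lt; lia.
  by exists (Some l); split=> //; rewrite !ffunE.
Qed.

End Bundles.

(** * Tight sets and the exchange property of [P r] for submodular [r] *)

Section Polymatroid.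
Context {m : nat} (r : {set 'I_m} -> nat).
Implicit Types (x y : 'I_m -> nat) (X Y : {set 'I_m}).

Local Notation full := [set: 'I_m]%SET.

Lemma vsum_setID x X Y : vsum x X = (vsum x (X :&: Y) + vsum x (X :\: Y))%N.
Proof.
rewrite !vsumE -big_split; apply: eq_bigr => j _ /=.
by rewrite !inE; case: (j \in X); case: (j \in Y); lia.
Qed.

Lemma ltn_vsum x y X l : (forall k : 'I_m, k \in X -> (x k <= y k)%N) -> l \in X ->
  (x l < y l)%N -> (vsum x X < vsum y X)%N.
Proof.
move=> le_xy lX lt_l; rewrite /vsum (bigD1 l) //= [X in (_ < X)%N](bigD1 l) //=.
by rewrite -addSn leq_add // leq_sum // => k /andP[/le_xy].
Qed.

(** An exchange raises the sum over a set only if the set contains [k] but not [j], and then by one;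
    a violated set was therefore tight. *)
Lemma exchange_notP x (j k : option 'I_m) : P r x -> j != k -> removable x j ->
  ~ P r (exchange x j k) -> exists X, [/\ oin k X, ~~ oin j X & vsum x X = r X].
Proof.
move=> xP jk xj /existsNP[X /negP]; rewrite -ltnNge => lt_r; exists X.
have := xP X; have := vsum_exchange X jk xj; move: lt_r.
by case: (oin k X); case: (oin j X) => /=; split => //; lia.
Qed.

Lemma P_remove x l : P r x -> (0 < x l)%N -> P r (exchange x (Some l) None).
Proof. by move=> xP xl; apply: contrapT => /(exchange_notP xP)[|//|X []]. Qed.

Hypothesis r_submod :
  forall X Y, (r (X :|: Y) + r (X :&: Y) <= r X + r Y)%N.

(** Uncrossing: [vsum x] is modular and [r] submodular, so neither inequality can be strict. *)
Lemma tightUI x X Y : P r x -> vsum x X = r X -> vsum x Y = r Y ->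
  vsum x (X :|: Y) = r (X :|: Y) /\ vsum x (X :&: Y) = r (X :&: Y).
Proof.
move=> xP xX xY; have := r_submod X Y; have := vsum_modular x X Y.
have := xP (X :|: Y); have := xP (X :&: Y); lia.
Qed.

Lemma min_tight x l X : P r x -> vsum x X = r X -> l \in X ->
  exists T, [/\ vsum x T = r T, l \in T
    & forall Y, vsum x Y = r Y -> l \in Y -> T \subset Y].
Proof.
move=> xP tX lX; have t0 : (vsum x X == r X) && (l \in X) by rewrite tX eqxx.
case: (@arg_minnP _ _ (fun X => (vsum x X == r X) && (l \in X)) (fun X => #|X|) t0).
move=> T /andP[/eqP tT lT] minT.
exists T; split=> // Y tY lY; have [_ tTY] := tightUI xP tT tY.
have := minT (T :&: Y); rewrite tTY eqxx inE lT lY => /(_ isT) cTY.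
have /eqP <- : T :&: Y == T by rewrite eqEcard finset.subsetIl.
exact: finset.subsetIr.
Qed.

Hypothesis r0 : r finset.set0 = 0%N.

Lemma max_tight x : P r x ->
  exists U, vsum x U = r U /\ forall X, vsum x X = r X -> X \subset U.
Proof.
move=> xP; have t0 : vsum x finset.set0 == r finset.set0 by rewrite vsum0 r0.
case: (@arg_maxnP _ _ (fun X => vsum x X == r X) (fun X => #|X|) t0) => U /eqP tU maxU.
exists U; split=> // X tX; have [tUX _] := tightUI xP tU tX.
have := maxU (U :|: X); rewrite tUX eqxx => /(_ isT) cUX.
have /eqP -> : U == U :|: X by rewrite eqEcard finset.subsetUl.
exact: finset.subsetUr.
Qed.

(* The exchange partner of j is found outside the largest tight set of
   x - chi_j and, if y + chi_j is not feasible, inside the smallest tight set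
   of y containing j. *)
Lemma P_hconvex : hconvex (P r).
Proof.
move=> x y [l|] xP yP; rewrite !ffunE => lt_l; last first.
  (* Here [j] is [None], so [x] has the smaller total; on the tight set [U] its sum is at least that
     of [y], hence [x] is below [y] at some good outside [U]. *)
  have [U [tU maxU]] := max_tight xP.
  have [k kU lt_k] : exists2 k, k \in ~: U & (x k < y k)%N.
    apply: vsum_lt; have := vsum_setC x U; have := vsum_setC y U.
    by have := yP U; rewrite -tU; lia.
  exists (Some k); rewrite !ffunE; split; first by lia.
    apply: contrapT => /(exchange_notP xP)[//|//|X [/= kX _ tX]].
    by move: kU; rewrite inE (fintype.subsetP (maxU _ tX)).
  by apply: P_remove => //; lia.
have {}lt_l : (y l < x l)%N by lia.
have xl : (0 < x l)%N by lia.
have x'P := P_remove xP xl.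
have x'E X : (vsum (exchange x (Some l) None) X + (l \in X) = vsum x X)%N.
  by rewrite (@vsum_exchange _ x (Some l) None) ?addn0.
have [U [tU maxU]] := max_tight x'P.
have lU : l \notin U by apply/negP => lU; have := x'E U; have := xP U; rewrite lU; lia.
have {}tU : vsum x U = r U by rewrite -tU -x'E (negbTE lU) addn0.
have neq (k : 'I_m) : (x k < y k)%N -> Some l != Some k.
  by move=> xk; apply/eqP => -[e]; move: xk; rewrite -e; lia.
have xlkP k : k \notin U -> (x k < y k)%N -> P r (exchange x (Some l) (Some k)).
  move=> kU /neq lk; apply: contrapT => /(exchange_notP xP)[//|//|X [/= kX lX tX]].
  by case/negP: kU; apply: (fintype.subsetP (maxU X _)) => //; rewrite -tX -x'E (negbTE lX) addn0.
have [ylP|/(exchange_notP yP)[//|//|X [/= lX _ tX]]] :=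
    pselect (P r (exchange y None (Some l))).
  have [yx|xy] := ltnP (vsum y full) (vsum x full).
    by exists None; split=> //; rewrite !ffunE; lia.
  have [k kU lt_k] : exists2 k, k \in ~: U & (x k < y k)%N.
    apply/exists_inP; apply: contraLR xy => /exists_inPn h; rewrite -ltnNge.
    rewrite -(vsum_setC x U) -(vsum_setC y U) tU -addnS leq_add ?yP //.
    by apply: (@ltn_vsum _ _ _ l) => // [k /h|]; rewrite ?inE -?leqNgt.
  rewrite inE in kU; exists (Some k); rewrite !ffunE; split; [lia | exact: xlkP |].
  apply: contrapT => /(exchange_notP yP)[|/=|X [/= lX _ tX]].
  - by rewrite eq_sym neq.
  - lia.
  - by have := ylP X; have := @vsum_exchange _ y None (Some l) X isT isT; rewrite /= lX; lia.
have [T [tT lT minT]] := min_tight yP tX lX.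
have [k kTU lt_k] : exists2 k, k \in T :\: U & (x k < y k)%N.
  apply/exists_inP; case: (boolP [exists k in T :\: U, (x k < y k)%N]) => // /exists_inPn h.
  exfalso.
  have : (vsum y (T :\: U) < vsum x (T :\: U))%N.
    by apply: (@ltn_vsum _ _ _ l) => // [k /h|]; rewrite ?inE -?leqNgt // lT lU.
  (* As [U] is tight for [x] and [T] for [y], submodularity gives x(T \ U) <= r(T ∪ U) - r(U) <=
     r(T) - r(T ∩ U) <= y(T \ U). *)
  have := vsum_setID y T U; have := vsum_setID x T U; have := vsum_modular x T U.
  have := r_submod T U; have := xP (T :|: U); have := yP (T :&: U); lia.
move: kTU; rewrite inE => /andP[kU kT].
exists (Some k); rewrite !ffunE; split; [lia | exact: xlkP |].
apply: contrapT => /(exchange_notP yP)[|/=|Y [/= lY kY tY]].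
- by rewrite eq_sym neq.
- lia.
- by case/negP: kY; apply: (fintype.subsetP (minT _ tY lY)).
Qed.

End Polymatroid.

(** * Minimal elements of a set with the exchange property, and their rank function *)

Section MinimalElements.
Context {m : nat} (D : set ('I_m -> nat)).
Hypothesis D_exchange : forall x y j, D x -> D y -> (y j < x j)%N ->
  exists k : option 'I_m, [/\ if k is Some l then (x l < y l)%N else true,
    D (exchange x (Some j) k) & D (exchange y k (Some j))].
Implicit Types (x y b c : 'I_m -> nat) (X Y : {set 'I_m}).

Local Notation full := [set: 'I_m]%SET.

Lemma minimals_below x : D x -> exists2 y, minimals D y & forall l, (y l <= x l)%N.
Proof.
have [n] := ubnP (vsum x full); elim: n x => // n IH x xn Dx.
have [xm|xm] := pselect (minimals D x); first by exists x.
have [y [Dy yx nyx]] : exists y, [/\ D y, (y <= x)%O & y <> x].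
  apply: contrapT => h; apply: xm; split=> // y Dy yx; apply: contrapT => nyx.
  by apply: h; exists y.
move: yx => /lefP yx.
have [l lt_l] : exists l, (y l < x l)%N.
  apply: contrapT => /forallNP h; apply: nyx; apply/funext => l.
  by apply/eqP; rewrite eqn_leq; have := yx l; rewrite leEnat => ->; rewrite leqNgt; apply/negP.
have lt_yx : (vsum y full < vsum x full)%N.
  by apply: (@ltn_vsum _ _ _ _ l) => // k _; have := yx k; rewrite leEnat.
have [z zm zy] := IH y (leq_trans lt_yx xn) Dy.
by exists z => // k; apply: leq_trans (zy k) _; have := yx k; rewrite leEnat.
Qed.

(** The partner [None] would produce an element of [D] strictly below [x]. *)
Lemma minimals_exchange_Some x y j : minimals D x -> D y -> (y j < x j)%N ->
  exists l, [/\ (x l < y l)%N, D (exchange x (Some j) (Some l))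
    & D (exchange y (Some l) (Some j))].
Proof.
move=> [Dx xm] Dy lt_j; have [[l|] [lt_l Dx' Dy']] := D_exchange Dx Dy lt_j.
  by exists l.
have ex l : (exchange x (Some j) None l + (Some j == Some l) = x l)%N.
  by rewrite exchangeE ?addn0 //=; apply: leq_ltn_trans lt_j.
have /(congr1 (@^~ j)) : exchange x (Some j) None = x.
  by apply: xm => //; apply/lefP => l; rewrite leEnat; have := ex l; lia.
by have := ex j; rewrite eqxx; lia.
Qed.

(** If [y] had the smaller total, an exchange of two goods would bring it closer to [x] with its
    total unchanged; the induction on the distance excludes this. *)
Lemma minimals_vsum x y : minimals D x -> D y -> (vsum x full <= vsum y full)%N.
Proof.
move=> xm; have [n] := ubnP (dist y x); elim: n y => // n IH y yn Dy.
rewrite ltnS in yn; rewrite leqNgt; apply/negP => lt_yx.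
have [j _ lt_j] := vsum_lt lt_yx.
have [l [lt_l _ Dy']] := minimals_exchange_Some xm Dy lt_j.
have lj : Some l != Some j by apply/eqP => -[e]; move: lt_l lt_j; rewrite e; lia.
have := IH _ (leq_trans (dist_exchange lt_j lt_l) yn) Dy'.
have := @vsum_exchange _ y (Some l) (Some j) full lj (leq_ltn_trans (leq0n _) lt_l).
by rewrite /= !inE; lia.
Qed.

Lemma minimals_of_vsum x : D x ->
  (forall y, D y -> (vsum x full <= vsum y full)%N) -> minimals D x.
Proof.
move=> Dx xmin; split=> // y Dy /lefP yx; apply: contrapT => nyx.
have le l : (y l <= x l)%N by have := yx l; rewrite leEnat.
have [l lt_l] : exists l, (y l < x l)%N.
  apply: contrapT => /forallNP h; apply: nyx; apply/funext => l.
  by apply/eqP; rewrite eqn_leq le leqNgt; apply/negP.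
by have := xmin _ Dy; rewrite leqNgt (@ltn_vsum _ _ _ _ l).
Qed.

Lemma minimals_vsum_eq x y : minimals D x -> minimals D y ->
  vsum x full = vsum y full.
Proof.
move=> xm ym; apply/eqP; rewrite eqn_leq.
by rewrite !minimals_vsum //; [case: xm | case: ym].
Qed.

(** Minimal elements are those of least total, and swapping one good for another keeps the total. *)
Lemma minimals_exchange x y j : minimals D x -> minimals D y -> (y j < x j)%N ->
  exists l, [/\ (x l < y l)%N, minimals D (exchange x (Some j) (Some l))
    & minimals D (exchange y (Some l) (Some j))].
Proof.
move=> xm ym lt_j.
have [l [lt_l Dx' Dy']] := minimals_exchange_Some xm (proj1 ym) lt_j.
have lj : Some l != Some j by apply/eqP => -[e]; move: lt_l lt_j; rewrite e; lia.
have ex := @vsum_exchange _ x (Some j) (Some l) full (ltac:(by rewrite eq_sym))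
  (leq_ltn_trans (leq0n _) lt_j).
have ey := @vsum_exchange _ y (Some l) (Some j) full lj (leq_ltn_trans (leq0n _) lt_l).
rewrite /= !inE in ex ey; exists l; split=> //; apply: minimals_of_vsum => // z Dz.
- by have := minimals_vsum xm Dz; lia.
- by have := minimals_vsum ym Dz; lia.
Qed.

Section Rank.
Variable r : {set 'I_m} -> nat.
Hypothesis r_ub : forall X b, minimals D b -> (vsum b X <= r X)%N.
Hypothesis r_att : forall X, exists2 b, minimals D b & vsum b X = r X.

(** Let [b] attain the rank of [Y] and [c] that of [X]. As long as [b] falls short on [X], an
    exchange either moves [c] towards [b] within [X], or moves [b] towards [c] without lowering its
    sum over [Y]. *)
Lemma rank_chain X Y : X \subset Y ->
  exists b, [/\ minimals D b, vsum b X = r X & vsum b Y = r Y].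
Proof.
move=> XY; have [b bm bY] := r_att Y; have [c cm cX] := r_att X.
have [n] := ubnP (dist b c); elim: n b c bm bY cm cX => // n IH b c bm bY cm cX.
rewrite ltnS => bn; have [bX|bX] := pselect (vsum b X = r X); first by exists b.
have : (vsum b X < vsum c X)%N.
  by rewrite cX ltn_neqAle r_ub // andbT; apply/eqP.
move=> /vsum_lt[j jX lt_j].
have [l [lt_l cm' bm']] := minimals_exchange cm bm lt_j.
have lj : Some l != Some j by apply/eqP => -[e]; move: lt_l lt_j; rewrite e; lia.
have [lX|lX] := boolP (l \in X).
- apply: (IH b (exchange c (Some j) (Some l))) => //.
    have := @vsum_exchange _ c (Some j) (Some l) X (ltac:(by rewrite eq_sym))
      (leq_ltn_trans (leq0n _) lt_j).
    by rewrite /= jX lX; lia.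
  rewrite distC; rewrite distC in bn; exact: leq_trans (dist_exchange lt_l lt_j) bn.
- apply: (IH (exchange b (Some l) (Some j)) c) => //.
    have := @vsum_exchange _ b (Some l) (Some j) Y lj (leq_ltn_trans (leq0n _) lt_l).
    rewrite /= (fintype.subsetP XY _ jX).
    by have := r_ub Y bm'; case: (l \in Y); lia.
  exact: leq_trans (dist_exchange lt_j lt_l) bn.
Qed.

(** A single minimal element attains the rank on both X ∩ Y and X ∪ Y, and its sums are modular. *)
Lemma rank_submod X Y : (r (X :|: Y) + r (X :&: Y) <= r X + r Y)%N.
Proof.
have XY : X :&: Y \subset X :|: Y.
  exact: fintype.subset_trans (finset.subsetIl _ _) (finset.subsetUl _ _).
have [b [bm <- <-]] := rank_chain XY.
by rewrite vsum_modular leq_add // r_ub.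
Qed.

Lemma rank0 : r finset.set0 = 0%N.
Proof. by have [b _ <-] := r_att finset.set0; rewrite vsum0. Qed.

End Rank.
End MinimalElements.

(** * Demand sets and the rank function [rho] *)

Section Demand.
Context {R : realType} {m : nat} (s : 'I_m -> nat) (v : ('I_m -> nat) -> R).
Context (q : 'I_m -> R -> R) (p : 'I_m -> R).
Hypothesis v_valuation : valuation s v.
Implicit Types (x y b : 'I_m -> nat) (X : {set 'I_m}).

Local Notation D := (demand s v q p).
Local Notation full := [set: 'I_m]%SET.

(** The payments are linear in the bundle and cancel in an exchange, so the utilities inherit the
    inequality of [v]; as [x] and [y] are both optimal, so are the exchanged bundles. *)
Lemma demand_exchange x y j : D x -> D y -> (y j < x j)%N ->
  exists k : option 'I_m, [/\ if k is Some l then (x l < y l)%N else true,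
    D (exchange x (Some j) k) & D (exchange y k (Some j))].
Proof.
move=> [xs xmax] [ys ymax] lt_j; case: v_valuation => _ _ _ vM.
have [k [kxy vle xs' ys']] := vM x y xs ys j lt_j.
have kj : k != Some j by apply/eqP => e; move: kxy; rewrite e; lia.
have xE l := @exchangeE _ x (Some j) k l (ltac:(by rewrite eq_sym))
  (leq_ltn_trans (leq0n _) lt_j).
have yk : removable y k by case: (k) kxy => //= l; lia.
have yE l := @exchangeE _ y k (Some j) l kj yk.
have uE : utility v q p x + utility v q p y <=
    utility v q p (exchange x (Some j) k) + utility v q p (exchange y k (Some j)).
  rewrite /utility ![_ - _ + (_ - _)]addrACA lerD // -!opprD lerN2 -!big_split /=.
  rewrite le_eqVlt; apply/orP; left; apply/eqP; apply: eq_bigr => l _.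
  by rewrite -!mulrDr -!natrD; congr (_ * _%:R); have := xE l; have := yE l; lia.
exists k; split=> //; split=> // z zs.
- by have := xmax _ zs; have := ymax _ ys'; move: uE; lra.
- by have := ymax _ zs; have := xmax _ xs'; move: uE; lra.
Qed.

Lemma demand_le x l : D x -> (x l <= s l)%N.
Proof. by move=> [/lefP /(_ l)]. Qed.

Lemma demand_nonempty : exists x, D x.
Proof.
have [||x [xs xmax]] := @bounded_max 'I_m _ R s [set x | (x <= s)%O] (utility v q p).
- by move=> x /lefP.
- by exists (fun=> 0%N); apply/lefP.
- by exists x.
Qed.

Lemma rho_max X : exists2 b, minimals D b & vsum b X = rho s v q p X /\
  forall c, minimals D c -> (vsum c X <= vsum b X)%N.
Proof.
have [||b [bm bmax]] := @bounded_max 'I_m _ nat s (minimals D) (vsum^~ X).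
- by move=> x [xD _] l; apply: demand_le.
- have [x xD] := demand_nonempty.
  by have [y ym _] := minimals_below xD; exists y.
exists b => //; split=> //; apply/esym/setmax_eq; split; first by exists b.
by move=> _ [c cm <-]; apply: bmax.
Qed.

Lemma rho_ub X b : minimals D b -> (vsum b X <= rho s v q p X)%N.
Proof. by move=> bm; have [c _ [<- cmax]] := rho_max X; apply: cmax. Qed.

Lemma rho_att X : exists2 b, minimals D b & vsum b X = rho s v q p X.
Proof. by have [c ? []] := rho_max X; exists c. Qed.

Lemma rho_submod X Y :
  (rho s v q p (X :|: Y) + rho s v q p (X :&: Y) <= rho s v q p X + rho s v q p Y)%N.
Proof. exact: (rank_submod demand_exchange rho_ub rho_att). Qed.

Lemma rho0 : rho s v q p finset.set0 = 0%N.
Proof. exact: (rank0 rho_att). Qed.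

Lemma rho1_le j : (rho s v q p [set j]%SET <= s j)%N.
Proof.
have [b [bD _] <-] := rho_att [set j]%SET.
by rewrite /vsum big_set1; apply: demand_le.
Qed.

Lemma rho_P_att X : exists2 b, P (rho s v q p) b & vsum b X = rho s v q p X.
Proof. by have [b bm <-] := rho_att X; exists b => // Y; apply: rho_ub. Qed.

(** The minimum over the demand is attained at minimal bundles. These have a common total, so
    demanding least on [X] means demanding most on its complement. *)
Lemma mu_rho X : (mu s v q p X + rho s v q p (~: X) = rho s v q p full)%N.
Proof.
pose V k := `[< exists2 b, minimals D b & vsum b X = k >].
have exV : exists k, V k.
  by have [b bm _] := rho_att X; exists (vsum b X); apply/asboolP; exists b.
case: (ex_minnP exV) => k /asboolP[c cm ck] kmin.
have -> : mu s v q p X = k.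
  apply: setmin_eq; split; first by exists c => //; case: cm.
  move=> _ [x xD <-]; have [y ym yx] := minimals_below xD.
  have : (k <= vsum y X)%N by apply: kmin; apply/asboolP; exists y.
  by move=> /leq_trans; apply; apply: leq_vsum => l _; apply: yx.
have const b : minimals D b -> vsum b full = rho s v q p full.
  have [b0 b0m <-] := rho_att full; move=> bm.
  exact: (minimals_vsum_eq demand_exchange).
apply/eqP; rewrite eqn_leq; apply/andP; split.
- have [b bm <-] := rho_att (~: X); rewrite -(const b bm) -(vsum_setC b X) leq_add2r.
  by apply: kmin; apply/asboolP; exists b.
- by rewrite -(const c cm) -(vsum_setC c X) -ck leq_add2l rho_ub.
Qed.

End Demand.

(** * Homogenized bundles under linear functionals, and sums in [Rgamma] *)

Section Homogenized.
Context {R : realType} {m : nat}.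
Implicit Types (x y : 'I_m -> nat) (u : option 'I_m -> Rgamma R).

Lemma big_option (V : nmodType) (I : finType) (F : option I -> V) :
  \sum_o F o = F None + \sum_i F (Some i).
Proof.
rewrite (bigD1 None) //=; congr (_ + _).
rewrite (reindex_omap Some id) /=; last by case.
by apply: eq_bigl => i; rewrite eqxx.
Qed.

Lemma lin_homog u y : u None = 0 -> lin u (homog y) = \sum_j u (Some j) *+ y j.
Proof.
move=> u0; rewrite /lin big_option u0 mul0rz add0r; apply: eq_bigr => j _.
by rewrite ffunE.
Qed.

Lemma homog_inj : injective (@homog m).
Proof.
move=> x y e; apply/funext => l; have := congr1 (fun f : {ffun option 'I_m -> int} => f (Some l)) e.
by rewrite !ffunE => -[].
Qed.

Lemma homog_arc x y (j k : option 'I_m) : j != k ->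
  homog x - unitv j + unitv k = homog y -> removable x j /\ y = exchange x j k.
Proof.
move=> jk e; have xj : removable x j.
  case: j jk e => [j|] //= jk /(congr1 (fun f : {ffun option 'I_m -> int} => f (Some j))).
  rewrite !ffunE eqxx (negbTE jk); lia.
by split=> //; apply: homog_inj; rewrite homog_exchange.
Qed.

Lemma gsum_ge0 (I : finType) (F : I -> Rgamma R) :
  (forall i, 0 <= F i) -> 0 <= \sum_i F i.
Proof. by move=> F0; apply: (big_ind (fun v => 0 <= v)) => //; exact: gaddr_ge0. Qed.

Lemma gsum_eq0 (I : finType) (F : I -> Rgamma R) :
  (forall i, 0 <= F i) -> \sum_i F i <= 0 -> forall i, F i = 0.
Proof.
move=> F0 + i; rewrite (bigD1 i) //=.
have : 0 <= \sum_(j | j != i) F j by apply: (big_ind (fun v => 0 <= v)) => //; exact: gaddr_ge0.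
by move: (F0 i) => /gleP /= a /gleP /= b /gleP /= c; apply: gext => /=; lra.
Qed.

Lemma gmulrn_ge0 (z : Rgamma R) n : 0 <= z -> 0 <= z *+ n.
Proof.
by move=> z0; elim: n => [|n IH]; rewrite ?mulr0n // mulrS gaddr_ge0.
Qed.

Lemma gmulrn_le0 (z : Rgamma R) n : 0 <= z -> (0 < n)%N -> z *+ n <= 0 -> z = 0.
Proof.
case: n => // n z0 _; rewrite mulrS; have := gmulrn_ge0 n z0.
by move: z0 => /gleP /= a /gleP /= b /gleP /= c; apply: gext => /=; lra.
Qed.

End Homogenized.

(** * Duality between allocations and prices *)

Section Allocation.
Context {R : realType} {m n : nat} (s : 'I_m -> nat).
Context (r : 'I_n -> {set 'I_m} -> nat) (w : 'I_n -> 'I_m -> Rgamma R).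
Hypothesis r_submod : forall i X Y,
  (r i (X :|: Y) + r i (X :&: Y) <= r i X + r i Y)%N.
Hypothesis r0 : forall i, r i finset.set0 = 0%N.
Implicit Types (x : 'I_n -> 'I_m -> nat) (z : 'I_m -> Rgamma R).

Local Notation full := [set: 'I_m]%SET.

Definition feasible x :=
  (forall i, P (r i) (x i)) /\ forall j, (\sum_i x i j <= s j)%N.

Definition objective x : Rgamma R := \sum_i \sum_j w i j *+ x i j.

Definition dual_value z : Rgamma R :=
  \sum_i setmax 0 [set \sum_j (w i j - z j) *+ x j | x in P (r i)]
  + \sum_j z j *+ s j.

Definition nonneg z := forall j, 0 <= z j.

Lemma P_le i (y : 'I_m -> nat) : P (r i) y -> forall j, (y j <= r i [set j]%SET)%N.
Proof. by move=> yP j; have := yP [set j]%SET; rewrite /vsum big_set1. Qed.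

Lemma P_0 i : P (r i) (fun=> 0%N).
Proof. by move=> X; rewrite /vsum big1. Qed.

Lemma optimum_exists :
  exists x, feasible x /\ forall y, feasible y -> objective y <= objective x.
Proof.
pose cur (f : 'I_n * 'I_m -> nat) : 'I_n -> 'I_m -> nat := fun i j => f (i, j).
pose unc x : 'I_n * 'I_m -> nat := fun ij => x ij.1 ij.2.
have [||f [fF fmax]] := @bounded_max ('I_n * 'I_m)%type _ (Rgamma R)
    (fun ij => r ij.1 [set ij.2]%SET) [set f | feasible (cur f)] (objective \o cur).
- by move=> f [fP _] [i j]; apply: (P_le (fP i) j).
- exists (fun=> 0%N); split=> [i|j]; [exact: P_0 | by rewrite big1].
- by exists (cur f); split=> // y yF; apply: (fmax (unc y)).
Qed.

Lemma setmax_P i z :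
  (exists2 y, P (r i) y & setmax 0 [set \sum_j (w i j - z j) *+ x j | x in P (r i)]
     = \sum_j (w i j - z j) *+ y j) /\
  forall y, P (r i) y -> \sum_j (w i j - z j) *+ y j <=
    setmax 0 [set \sum_j (w i j - z j) *+ x j | x in P (r i)].
Proof.
have [||y [yP ymax]] := @bounded_max 'I_m _ (Rgamma R) (fun j => r i [set j]%SET)
    (P (r i)) (fun y => \sum_j (w i j - z j) *+ y j).
- exact: P_le.
- by exists (fun=> 0%N); apply: P_0.
have -> : setmax 0 [set \sum_j (w i j - z j) *+ x j | x in P (r i)]
    = \sum_j (w i j - z j) *+ y j.
  by apply: setmax_eq; split; [exists y | move=> _ [y' y'P <-]; apply: ymax].
by split=> //; exists y.
Qed.

Section Optimum.
Variable x : 'I_n -> 'I_m -> nat.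
Hypothesis x_feasible : feasible x.
Hypothesis x_max : forall y, feasible y -> objective y <= objective x.

Definition unsold j : nat := (s j - \sum_i x i j)%N.

Lemma unsoldE j : (\sum_i x i j + unsold j = s j)%N.
Proof. by rewrite /unsold subnKC //; case: x_feasible. Qed.

(* The buyer None takes the unsold units. *)
Definition bundles (o : option 'I_n) : set {ffun option 'I_m -> int} :=
  homog @` (if o is Some i then P (r i) else setT).

Definition weights (o : option 'I_n) (k : option 'I_m) : Rgamma R :=
  if o is Some i then if k is Some j then w i j else 0 else 0.

Definition allocation (o : option 'I_n) : {ffun option 'I_m -> int} :=
  homog (if o is Some i then x i else unsold).

(** Price 0 for no good fixes the additive constant of a potential. *)
Definition ext0 z (k : option 'I_m) : Rgamma R := if k is Some j then z j else 0.

Lemma bundles_convex o : mconvex (bundles o).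
Proof.
case: o => [i|]; apply: hconvex_mconvex; last exact: hconvexT.
exact: P_hconvex (r_submod i) (r0 i).
Qed.

Lemma allocation_bundles o : bundles o (allocation o).
Proof. by case: o => [i|]; [exists (x i) => //; case: x_feasible | exists unsold]. Qed.

Lemma lin_weights_None y : lin (weights None) y = 0.
Proof. by rewrite /lin big1 // => j _; rewrite mul0rz. Qed.

(** With equal totals, the bundles including that of the extra buyer add up to [s], so the other
    buyers receive at most [s]. *)
Lemma allocation_max (y : option 'I_n -> {ffun option 'I_m -> int}) :
  (forall o, bundles o (y o)) -> \sum_o y o = \sum_o allocation o ->
  \sum_o lin (weights o) (y o) <= \sum_o lin (weights o) (allocation o).
Proof.
move=> yB ysum.
have /choice[a aP] : forall o, exists a : 'I_m -> nat,
    (if o is Some i then P (r i) a else True) /\ homog a = y o.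
  by move=> o; have := yB o; case: o => [i|] [a aP <-]; exists a.
have aF : feasible (fun i => a (Some i)).
  split=> [i|j]; first by have [] := aP (Some i).
  have := congr1 (fun f : {ffun option 'I_m -> int} => f (Some j)) ysum.
  rewrite !sum_ffunE !big_option /= -(aP None).2 /allocation !ffunE => e.
  have e2 : (\sum_i a (Some i) j + a None j = \sum_i x i j + unsold j)%N.
    apply/eqP; rewrite -eqz_nat !PoszD !(big_morph _ PoszD (erefl (Posz 0))).
    rewrite addrC [X in _ == X]addrC; apply/eqP; move: e.
    by congr (_ + _ = _ + _); apply: eq_bigr => i _; rewrite -?(aP (Some i)).2 ffunE.
  by rewrite unsoldE in e2; rewrite -e2 leq_addr.
rewrite !big_option !lin_weights_None !add0r.
have := x_max aF; rewrite /objective; congr (_ <= _); apply: eq_bigr => i _.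
  by rewrite -(aP (Some i)).2 lin_homog.
by rewrite lin_homog.
Qed.

(** Complementary slackness for the supply, and local optimality of each [x i] at the prices [z]. *)
Definition dual_optimal z := [/\ nonneg z,
  forall j, (0 < unsold j)%N -> z j = 0
  & forall i j k, j != k -> removable (x i) j -> P (r i) (exchange (x i) j k) ->
      ext0 z j + (weights (Some i) k - weights (Some i) j) <= ext0 z k].

Lemma ext0_ge0 z : nonneg z -> forall k, 0 <= ext0 z k.
Proof. by move=> z0 [k|] /=. Qed.

(** The extra buyer encodes the first two conditions: its arcs leaving [None] give nonnegativity,
    and its arcs from an unsold good to [None] give price at most 0. *)
Lemma potentialP z : potential bundles weights allocation (ext0 z) <-> dual_optimal z.
Proof.
split=> [pot_z|[z0 zleft zarc]].
- have arcT j k : j != k -> removable unsold j -> ext0 z j <= ext0 z k.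
    move=> jk lj; have := pot_z None j k.
    rewrite /exch /allocation -homog_exchange // subrr addr0; apply.
    by exists (exchange unsold j k).
  have z0 : nonneg z by move=> j; apply: (arcT None (Some j)).
  split=> // [j lj|i j k jk xj xP].
    by apply/le_anti; rewrite z0 (arcT (Some j) None).
  by apply: pot_z; rewrite /exch /allocation -homog_exchange //; exists (exchange (x i) j k).
- move=> [i|] j k; have [->|jk] := eqVneq j k; rewrite ?subrr ?addr0 //.
    move=> [y yP /esym e]; have [xj ye] := homog_arc jk e.
    by apply: zarc => //; rewrite -ye.
  move=> [y _ /esym e]; have [lj _] := homog_arc jk e.
  case: j jk e lj => [j|] jk e lj /=; last exact: ext0_ge0.
  by rewrite zleft //; apply: ext0_ge0.
Qed.

Lemma lagrangian z : \sum_i \sum_j (w i j - z j) *+ x i j + \sum_j z j *+ s j =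
  objective x + \sum_j z j *+ unsold j.
Proof.
have -> : \sum_j z j *+ s j = \sum_i \sum_j z j *+ x i j + \sum_j z j *+ unsold j.
  rewrite exchange_big -big_split; apply: eq_bigr => j _ /=.
  by rewrite sumrMnr -mulrnDr unsoldE.
rewrite addrA -big_split; congr (_ + _); apply: eq_bigr => i _.
by rewrite -big_split; apply: eq_bigr => j _ /=; rewrite -mulrnDl subrK.
Qed.

(** The gap is the value of the unsold units plus the amounts by which the maxima of the buyers
    exceed the values of the [x i]. *)
Lemma weak_duality z : nonneg z -> objective x <= dual_value z.
Proof.
move=> z0; have -> : dual_value z = objective x + (\sum_j z j *+ unsold j +
   \sum_i (setmax 0 [set \sum_j (w i j - z j) *+ x j | x in P (r i)]
           - \sum_j (w i j - z j) *+ x i j)).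
  by rewrite addrA -lagrangian sumrB /dual_value; apply: gext => /=; lra.
rewrite -gsub_ge0 addrAC subrr add0r; apply: gaddr_ge0.
  by apply: gsum_ge0 => j; apply: gmulrn_ge0.
apply: gsum_ge0 => i; rewrite gsub_ge0; apply: (setmax_P i z).2.
by case: x_feasible.
Qed.

Lemma dual_optimal_max z i (y : 'I_m -> nat) : dual_optimal z -> P (r i) y ->
  \sum_j (w i j - z j) *+ y j <= \sum_j (w i j - z j) *+ x i j.
Proof.
move=> /potentialP zpot yP; pose u k := weights (Some i) k - ext0 z k.
have lu y' : lin u (homog y') = \sum_j (w i j - z j) *+ y' j.
  by rewrite lin_homog // /u subrr.
rewrite -!lu; apply: (local_global (@bundles_convex (Some i))).
- exact: (allocation_bundles (Some i)).
- move=> j k /(zpot (Some i)) /gleP /= h; apply/gleP => /=; rewrite /u; lra.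
- by exists y.
Qed.

(** Local optimality of each [x i] is global, which closes the duality gap. Conversely, if the gap
    is zero, each of its nonnegative terms vanishes. *)
Lemma dual_optimalP z : dual_optimal z <-> nonneg z /\ dual_value z = objective x.
Proof.
split=> [zopt|[z0 zx]].
- have [z0 zleft _] := zopt; split=> //.
  have -> : dual_value z = \sum_i \sum_j (w i j - z j) *+ x i j + \sum_j z j *+ s j.
    rewrite /dual_value; congr (_ + _); apply: eq_bigr => i _; apply: setmax_eq.
    split; first by exists (x i) => //; case: x_feasible.
    by move=> _ [y yP <-]; apply: dual_optimal_max.
  rewrite lagrangian big1 ?addr0 // => j _.
  by case: (posnP (unsold j)) => [->|/zleft ->]; rewrite ?mulr0n ?mul0rn.
- have a0 j : 0 <= z j *+ unsold j by apply: gmulrn_ge0.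
  have b0 i : 0 <= setmax 0 [set \sum_j (w i j - z j) *+ x j | x in P (r i)]
           - \sum_j (w i j - z j) *+ x i j.
    rewrite gsub_ge0; apply: (setmax_P i z).2.
    by case: x_feasible.
  have [A B] : \sum_j z j *+ unsold j <= 0 /\
   \sum_i (setmax 0 [set \sum_j (w i j - z j) *+ x j | x in P (r i)]
           - \sum_j (w i j - z j) *+ x i j) <= 0.
    move: zx (lagrangian z) (gsum_ge0 a0) (gsum_ge0 b0); rewrite sumrB /dual_value.
    set t1 := \sum_i setmax _ _; set t2 := \sum_i \sum_j _; set t3 := \sum_j _ *+ s _.
    set t4 := \sum_j _ => zx la; have [e1 e2] : t1.1 - t2.1 = - t4.1 /\ t1.2 - t2.2 = - t4.2.
      by move: (congr1 fst zx) (congr1 snd zx) (congr1 fst la) (congr1 snd la) => /=; lra.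
    by move=> /gleP /= a /gleP /= b; split; apply/gleP => /=; lra.
  apply/potentialP => -[i|] j k; have [->|jk] := eqVneq j k; rewrite ?subrr ?addr0 //.
  + move=> [y yP /esym e]; have := (setmax_P i z).2 y yP.
    pose u k := weights (Some i) k - ext0 z k.
    have lu y' : lin u (homog y') = \sum_j (w i j - z j) *+ y' j.
      by rewrite lin_homog // /u subrr.
    have /eqP := gsum_eq0 b0 B i; rewrite subr_eq0 => /eqP ->.
    rewrite -!lu -e /allocation !linD linN !lin_unitv /u.
    by move=> /gleP /= h; apply/gleP => /=; lra.
  + move=> [y _ /esym e]; have [lj _] := homog_arc jk e.
    case: j jk e lj => [j|] jk e lj /=; last exact: ext0_ge0.
    rewrite (@gmulrn_le0 _ (z j) (unsold j)) ?ext0_ge0 //.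
    by rewrite (gsum_eq0 a0 A j).
Qed.

Lemma least_dual_optimal :
  exists2 z, dual_optimal z & forall z', dual_optimal z' -> forall j, z j <= z' j.
Proof.
pose F := pot bundles weights allocation #|{: option 'I_m}|.
have Fpot : potential bundles weights allocation F.
  exact: (pot_potential (@bundles_convex) allocation_bundles allocation_max).
have F0 k : 0 <= F k by exact: (@pot_le _ _ _ _ _ _ 0%N).
have Fleast z : dual_optimal z -> forall k, F k <= ext0 z k.
  move=> zopt k; rewrite /F; apply: pot_least; first by apply: ext0_ge0; case: zopt.
  exact/potentialP.
(* The shifted potential is a dual optimal vector, whose value at [None] is 0; as [F] lies below it,
   [F None] vanishes. *)
have z1 : dual_optimal (fun j => F (Some j) - F None).
  apply/potentialP => o j k /Fpot.
  have E k' : ext0 (fun j => F (Some j) - F None) k' = F k' - F None.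
    by case: k' => [//|]; rewrite subrr.
  by rewrite !E => /gleP /= h; apply/gleP => /=; lra.
have FN : F None = 0 by apply/le_anti; rewrite F0 (Fleast _ z1 None).
exists (F \o Some); last by move=> z' /Fleast le j; exact: (le (Some j)).
apply/potentialP => o j k.
have E k' : ext0 (F \o Some) k' = F k' by case: k'.
by rewrite !E; apply: Fpot.
Qed.

(** Each inequality bounds one coordinate below by a translate of one other coordinate, so it passes
    to meets and joins. *)
Lemma dual_optimal_lattice z z' : dual_optimal z -> dual_optimal z' ->
  dual_optimal (fun j => Order.meet (z j) (z' j)) /\
  dual_optimal (fun j => Order.join (z j) (z' j)).
Proof.
move=> /potentialP zp /potentialP zp'.
have Emeet k : ext0 (fun j => Order.meet (z j) (z' j)) k = Order.meet (ext0 z k) (ext0 z' k).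
  by case: k => //=; rewrite meetxx.
have Ejoin k : ext0 (fun j => Order.join (z j) (z' j)) k = Order.join (ext0 z k) (ext0 z' k).
  by case: k => //=; rewrite joinxx.
split; apply/potentialP => o j k a; rewrite ?Emeet ?Ejoin.
- rewrite lexI; apply/andP; split.
    by apply: le_trans (zp _ _ _ a); rewrite gleD2r leIl.
  by apply: le_trans (zp' _ _ _ a); rewrite gleD2r leIr.
- rewrite gleBDr leUx -!gleBDr; apply/andP; split.
    by apply: le_trans (zp _ _ _ a) _; rewrite leUl.
  by apply: le_trans (zp' _ _ _ a) _; rewrite leUr.
Qed.

(** * Real parts of the optimal prices *)

Hypothesis r_att : forall i X, exists2 b, P (r i) b & vsum b X = r i X.
Hypothesis r1_le : forall i j, (r i [set j]%SET <= s j)%N.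
Implicit Types X Y : {set 'I_m}.

(** By [mu_rho], this is a constant minus the over-demand when [r] is [rho]; it is also an upper
    bound on the number of units sold. *)
Definition cover X : nat := (\sum_i r i (~: X) + vsum s X)%N.

(** The case of equality in that bound. *)
Definition complementary X :=
  (forall i, vsum (x i) (~: X) = r i (~: X)) /\ forall j, j \in X -> unsold j = 0%N.

Local Notation sold := (\sum_i vsum (x i) full)%N.

Lemma vsum_supply X : vsum s X = (\sum_i vsum (x i) X + vsum unsold X)%N.
Proof.
rewrite /vsum exchange_big -big_split; apply: eq_bigr => j _ /=.
by rewrite unsoldE.
Qed.

Lemma sold_setC X : sold = (\sum_i vsum (x i) (~: X) + \sum_i vsum (x i) X)%N.
Proof. by rewrite -big_split; apply: eq_bigr => i _ /=; rewrite addnC vsum_setC. Qed.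

Lemma complementaryP X : (cover X <= sold)%N <-> complementary X.
Proof.
rewrite (sold_setC X) /cover vsum_supply; split=> [le|[tX uX]].
- have le' i : (vsum (x i) (~: X) <= r i (~: X))%N by case: x_feasible => /(_ i).
  have U0 : vsum unsold X = 0%N.
    have : (\sum_i vsum (x i) (~: X) <= \sum_i r i (~: X))%N by apply: leq_sum.
    move=> le2; move: le; rewrite addnCA [leqRHS]addnC leq_add2l => le.
    by have := leq_trans le le2; rewrite -[leqRHS]addn0 leq_add2l leqn0 => /eqP.
  split=> [i|j jX].
    move: le; rewrite U0 addn0 leq_add2r (bigD1 i) //= [X in (_ <= X)%N](bigD1 i) //=.
    have : (\sum_(k | k != i) vsum (x k) (~: X) <= \sum_(k | k != i) r k (~: X))%N.
      by apply: leq_sum.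
    have aux (a b c d : nat) : (a <= b -> c <= d -> b + d <= a + c -> a = b)%N by lia.
    exact: aux (le' i).
  by move/eqP: U0; rewrite /vsum (bigD1 j) //= addn_eq0 => /andP[/eqP].
- rewrite addnCA addnC -addnA leq_add ?leq_sum // => [i _|]; first by rewrite tX.
  by rewrite /vsum big1 // => j jX; apply: uX.
Qed.

Lemma sold_le_cover X : (sold <= cover X)%N.
Proof.
rewrite (sold_setC X) /cover vsum_supply addnA -addnA leq_add ?leq_addr //.
by apply: leq_sum => i _; case: x_feasible => /(_ i).
Qed.

Lemma complementaryI X Y : complementary X -> complementary Y -> complementary (X :&: Y).
Proof.
move=> [tX uX] [tY uY]; split=> [i|j]; last by rewrite inE => /andP[/uX].
by rewrite finset.setCI; have [xP _] := x_feasible; have [] := tightUI (r_submod i) (xP i) (tX i) (tY i).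
Qed.

(** If [x i] fell short on [X], an exchange with a bundle [b] attaining the rank would bring some
    [k] of [X] into [x i]. Giving up nothing or a good outside [X] for it contradicts the prices;
    giving up a good of [X] brings [b] closer to [x i]. *)
Lemma dual_optimal_tight z i X : dual_optimal z ->
  (forall k, k \in X -> z k < w i k) ->
  (forall k j, k \in X -> j \notin X -> w i j - z j < w i k - z k) ->
  vsum (x i) X = r i X.
Proof.
move=> [_ _ zarc] pos lvl; have [xP _] := x_feasible.
have [b bP bX] := r_att i X.
have [N] := ubnP (dist b (x i)); elim: N b bP bX => // N IH b bP bX bN.
apply/eqP; rewrite eqn_leq xP leqNgt; apply/negP; rewrite -bX => lt_b.
have [k kX lt_k] := vsum_lt lt_b.
have lt_h : homog (x i) (Some k) < homog b (Some k) by rewrite !ffunE.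
have [c [lt_c bP' xP']] := P_hconvex (r_submod i) (r0 i) bP (xP i) lt_h.
have ck : c != Some k by apply/eqP => e; move: lt_c lt_h; rewrite e; lia.
move: (zarc i c (Some k) ck (homog_lt_removable lt_c) xP') => /=.
case: c lt_c ck bP' xP' => [j|] lt_c ck bP' xP' /=; last first.
  by rewrite add0r subr0 leNgt pos.
have [jX _|jX] := boolP (j \in X).
  rewrite !ffunE in lt_c; have lt_j : (b j < x i j)%N by lia.
  have e : vsum (exchange b (Some k) (Some j)) X = r i X.
    have := @vsum_exchange _ b (Some k) (Some j) X (ltac:(by rewrite eq_sym))
      (leq_ltn_trans (leq0n _) lt_k).
    by rewrite -bX /= jX kX => /eqP; rewrite eqn_add2r => /eqP.
  rewrite ltnS in bN.
  by move: lt_b; rewrite (IH _ bP' e (leq_trans (dist_exchange lt_j lt_k) bN)) bX ltnn.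
move: (lvl _ _ kX jX) => /gltP /= h /gleP /= h'.
have : (0 : R) < 0 by lra.
by rewrite ltxx.
Qed.

Hypothesis w1 : forall i j, (w i j).1 = 1.

(** All weights have real part 1. Hence goods with price of real part at most [t < 1] yield a
    positive gain, larger than that of the goods above [t], whatever the coefficients of gamma. *)
Lemma complementary_level z (t : R) : dual_optimal z -> 0 <= t -> t < 1 ->
  complementary [set k | t < (z k).1]%SET.
Proof.
move=> zopt t0 t1; have [_ zunsold _] := zopt; split=> [i|j].
- apply: (dual_optimal_tight zopt) => k; first move=> kX; last move=> j kX jX.
    by apply/gltP => /=; rewrite w1; move: kX; rewrite !inE -leNgt; lra.
  by apply/gltP => /=; rewrite !w1; move: kX jX; rewrite !inE negbK -leNgt; lra.
- rewrite inE => lt_j; case: (posnP (unsold j)) => // /zunsold e.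
  by move: lt_j; rewrite e ltNge t0.
Qed.

Variable Xmin : {set 'I_m}.
Hypothesis Xmin_min : forall Y, (cover Xmin <= cover Y)%N.
Hypothesis Xmin_minimal : forall Y, (forall Z, (cover Y <= cover Z)%N) ->
  Y \subset Xmin -> Y = Xmin.

(** The level set at 0 attains the lower bound on [cover], so every minimizer of [cover] does. *)
Lemma Xmin_complementary z : dual_optimal z -> complementary Xmin.
Proof.
move=> zopt; apply/complementaryP.
have /complementaryP := complementary_level zopt (lexx 0) ltr01.
exact: leq_trans (Xmin_min _).
Qed.

(** The intersection of both sets is complementary, hence again a minimizer of [cover]. *)
Lemma Xmin_sub X : complementary Xmin -> complementary X -> Xmin \subset X.
Proof.
move=> cmin cX; have /complementaryP cI := complementaryI cmin cX.
have <- := Xmin_minimal _ (finset.subsetIl Xmin X); first exact: finset.subsetIr.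
by move=> Z; apply: leq_trans cI (sold_le_cover Z).
Qed.

(** A good without supply has rank 0 for every buyer, so dropping it from [Xmin] would not raise the
    cover. *)
Lemma Xmin_supply j : j \in Xmin -> (0 < s j)%N.
Proof.
move=> jX; rewrite lt0n; apply/eqP => sj.
have le : (cover (Xmin :\ j) <= cover Xmin)%N.
  apply: leq_add; last first.
    by rewrite /vsum [X in (_ <= X)%N](big_setD1 j) //= leq_addl.
  apply: leq_sum => i _; rewrite finset.setCD finset.setUC.
  have := r_submod i [set j]%SET (~: Xmin); have := r1_le i j.
  by rewrite sj; lia.
have : Xmin :\ j = Xmin.
  apply: Xmin_minimal (finset.subD1set Xmin j) => Z; exact: leq_trans le (Xmin_min Z).
by move=> /setP /(_ j); rewrite !inE eqxx jX.
Qed.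

(** Otherwise the level set at the real part of [z j] would be complementary, yet miss [j]. *)
Lemma dual_optimal_Xmin_ge z j : dual_optimal z -> j \in Xmin -> 1 <= (z j).1.
Proof.
move=> zopt jX; rewrite leNgt; apply/negP => lt1.
have z0 : 0 <= (z j).1 by case: zopt => /(_ j) /gleP /= [|[]]; lra.
have := fintype.subsetP (Xmin_sub (Xmin_complementary zopt)
  (complementary_level zopt z0 lt1)) _ jX.
by rewrite inE ltxx.
Qed.

(** The supply of [j] is positive and fully sold, so some buyer holds a unit; since giving it up is
    feasible, [z j] is at most the weight. *)
Lemma dual_optimal_Xmin_le z j : dual_optimal z -> j \in Xmin -> (z j).1 <= 1.
Proof.
move=> zopt jX; have [_ uX] := Xmin_complementary zopt.
have [i xij] : exists i, (0 < x i j)%N.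
  apply: contrapT => /forallNP h; have := Xmin_supply jX.
  rewrite -(unsoldE j) (uX _ jX) addn0 big1 // => i _.
  by apply/eqP; rewrite -leqn0 leqNgt; apply/negP.
have [xP _] := x_feasible; have [_ _ zarc] := zopt.
move: (zarc i (Some j) None isT xij (P_remove (xP i) xij)) => /=.
by move=> /gleP /=; rewrite w1; lra.
Qed.

(* Off Xmin, a positive real part of the prices can be lowered: no exchange
   moves a unit from Xmin to its complement. *)
Lemma least_dual_optimal_off z j : dual_optimal z ->
  (forall z', dual_optimal z' -> forall k, z k <= z' k) ->
  j \notin Xmin -> (z j).1 = 0.
Proof.
move=> zopt zleast jX; have [z0 zunsold zarc] := zopt.
have [tX _] := Xmin_complementary zopt.
have z01 k : 0 <= (z k).1 by move: (z0 k) => /gleP /= [|[]]; lra.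
apply/eqP; rewrite eq_le z01 andbT leNgt; apply/negP => zj.
have [k0 [zk0 kmin]] : exists k, 0 < (z k).1 /\
    forall l, 0 < (z l).1 -> (z k).1 <= (z l).1.
  case: (@Order.TotalTheory.arg_minP _ _ _ j (fun k => 0 < (z k).1) (fun k => (z k).1) zj).
  by move=> k zk kmin; exists k.
(* Half of the least positive real part, so that lowered prices keep a positive real part. *)
pose e := (z k0).1 / 2.
pose Z k := (k \notin Xmin) && (0 < (z k).1).
pose z' k : Rgamma R := if Z k then z k - (e, 0) else z k.
have z'le k : ext0 z' k <= ext0 z k.
  case: k => //= k; rewrite /z'; case: ifP => // _.
  by apply/gleP => /=; rewrite /e; lra.
have z'Z k : Z k -> 0 < (z' k).1 /\ z' k = z k - (e, 0).
  move=> Zk; rewrite /z' Zk; split=> //; case/andP: Zk => _ /kmin h.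
    by rewrite /e /=; lra.
have z'nZ k : ~~ Z k -> z' k = z k by move=> /negbTE; rewrite /z' => ->.
have z'0 : nonneg z'.
  move=> k; have [/z'Z [h _]|/z'nZ -> //] := boolP (Z k).
  by apply/gleP => /=; lra.
have z'opt : dual_optimal z'.
  split=> // [k uk|i a k ak xa xP'].
    rewrite z'nZ ?zunsold //; by apply/negP => /andP[_]; rewrite zunsold //= ltxx.
  have h := zarc i a k ak xa xP'.
  have down : ext0 z' k = ext0 z k -> ext0 z' a + (weights (Some i) k - weights (Some i) a) <= ext0 z' k.
    by move=> ->; apply: le_trans h; rewrite gleD2r.
  case: k ak xP' h down => [k|] ak xP' h down; last exact: down.
  have [Zk|nZk] := boolP (Z k); last by apply: down; rewrite /= z'nZ.
  have [z'k z'kE] := z'Z _ Zk; case/andP: Zk => kX zk.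
  have contra : ~~ oin a (~: Xmin) -> False.
    move=> aX; have := xP' (~: Xmin); have := vsum_exchange (~: Xmin) ak xa.
    by rewrite (negbTE aX) /= inE kX tX addn0 addn1 => ->; rewrite ltnn.
  case: a ak xa xP' h down contra => [a|] ak xa xP' h down contra; last by case: contra.
  have [aX|aX] := boolP (a \in Xmin); first by case: contra; rewrite /= inE aX.
  have [Za|nZa] := boolP (Z a).
    have [_ z'aE] := z'Z _ Za; rewrite /= z'kE z'aE.
    by move: h => /gleP /= h; apply/gleP => /=; lra.
  (* The weights have equal real parts, so the left side has real part 0, below that of [z' k]. *)
  have za : (z a).1 = 0.
    by apply/eqP; rewrite eq_le z01 andbT leNgt; move: nZa; rewrite /Z aX.
  apply/gleP; left; rewrite /= z'nZ //= !w1 za; lra.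
have := zleast _ z'opt j; have [_ ->] := z'Z j (ltac:(by rewrite /Z jX)).
rewrite -gsub_ge0 => /gleP /= h; have : (0 : R) < 0 by rewrite /e in h; lra.
by rewrite ltxx.
Qed.

Lemma least_dual_optimal_fst z j : dual_optimal z ->
  (forall z', dual_optimal z' -> forall k, z k <= z' k) ->
  (z j).1 = (j \in Xmin)%:R.
Proof.
move=> zopt zleast; have [jX|jX] := boolP (j \in Xmin).
  by apply/eqP; rewrite eq_le dual_optimal_Xmin_le ?dual_optimal_Xmin_ge.
exact: least_dual_optimal_off jX.
Qed.

End Optimum.
End Allocation.

Theorem theorem4p3 (R : realType) (m n : nat) (s : 'I_m -> nat)
    (v : 'I_n -> ('I_m -> nat) -> R) (q : 'I_n -> 'I_m -> R -> R)
    (p : 'I_m -> R) (Xstar : {set 'I_m}) :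
  (2 <= n)%N ->
  (forall i, valuation s (v i)) ->
  (forall i j, payment s (v i) j (q i j)) ->
  (forall j, 0 <= p j) ->
  minimal_maximizer (overdemand s v q p) Xstar ->
  [/\ sublattice (D2_minimizers s v q p),
      exists! z, minimals (D2_minimizers s v q p) z,
      exists a : Rgamma R,
        is_min (D2_objective s v q p @` D2_feasible) a /\
        is_max (P2_objective q p @` P2_feasible s v q p) a
    & forall zstar, minimals (D2_minimizers s v q p) zstar ->
        exists t : 'I_m -> R,
          forall j, zstar j = (j \in Xstar)%:R +γ t j].
Proof.
move=> _ v_val _ _ [Xmax Xminimal].
pose r i := rho s (v i) (q i) p; pose w := weight q p.
have r_submod i := @rho_submod _ _ s (v i) (q i) p (v_val i).
have r0 i : r i finset.set0 = 0%N by apply: rho0.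
have [x [xF xmax]] : exists x, feasible s r x /\
    forall y, feasible s r y -> objective w y <= objective w x.
  exact: optimum_exists.
have [z0 z0opt z0least] := least_dual_optimal r_submod r0 xF xmax.
have optP z : dual_optimal s r w x z <-> nonneg z /\ dual_value s r w z = objective w x.
  exact: dual_optimalP.
have weak z : nonneg z -> objective w x <= dual_value s r w z.
  exact: weak_duality.
have minP z : D2_minimizers s v q p z <-> dual_optimal s r w x z.
  split=> [[zF zmin]|/optP[zF zx]].
    apply/optP; split=> //; apply/le_anti; rewrite weak // andbT.
    by have /optP[z0F <-] := z0opt; apply: zmin.
  by split=> // z' z'F; rewrite [leLHS]zx; apply: weak.
(* [z0] is below every minimizer, so it is the only minimal one. *)
have least_min z : minimals (D2_minimizers s v q p) z <-> z = z0.
  split=> [[/minP zopt zmin]|->].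
    apply/esym/zmin; first exact/minP.
    by apply/lefP => j; apply: z0least.
  split=> [|y /minP yopt /lefP yz0]; first exact/minP.
  by apply/funext => j; apply/le_anti; rewrite yz0 z0least.
split.
- move=> z z' /minP zopt /minP z'opt.
  have [? ?] := dual_optimal_lattice zopt z'opt.
  by split; apply/minP.
- by exists z0; split=> [|z /least_min]; [exact/least_min|].
- exists (objective w x); split; split.
  + by have /optP[z0F z0x] := z0opt; exists z0.
  + by move=> _ [z zF <-]; apply: weak.
  + by exists x.
  + by move=> _ [y yF <-]; apply: xmax.
(* Over-demand is a constant minus [cover], so [Xstar] is an inclusion-minimal minimizer of [cover],
   as required of [Xmin]. *)
- have odE X : overdemand s v q p X = (\sum_i r i [set: 'I_m]%SET)%N%:Z - (cover s r X)%:Z.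
    rewrite /overdemand /cover.
    have -> : (\sum_i r i [set: 'I_m]%SET = \sum_i mu s (v i) (q i) p X + \sum_i r i (~: X))%N.
      by rewrite -big_split; apply: eq_bigr => i _; rewrite /= mu_rho.
    by rewrite -/r !PoszD opprD addrA addrK.
  have leE X Y : (overdemand s v q p X <= overdemand s v q p Y) = (cover s r Y <= cover s r X)%N.
    by rewrite !odE lerD2l lerN2.
  move=> zstar /least_min ->; exists (fun j => (z0 j).2) => j.
  apply: gext => //; apply: least_dual_optimal_fst z0opt z0least => //.
  + by move=> i X; apply: rho_P_att.
  + by move=> i k; apply: rho1_le.
  + by move=> Y; rewrite -leE.
  + by move=> Y Ymin; apply: Xminimal => Z; rewrite leE.
Qed.
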